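(* Let $M$ be an admissible matrix of size $(a,b)$ which is plain and $\Delta$-regular, and suppose that one of the following conditions holds: 1. $a_{ij}\ge a_{i-1\,j+1}$ for any $i,j\ge 0$; 2. $b_{ij}\ge b_{i+1\,j-1}$ for any $i,j\ge 0$. Let $Z$ be a zero-dimensional scheme associated to $M$. Then $M(i,j)=M_Z(i,j)$ for any $(i,j)$.
   Context: **Ground.** Let $k$ be an algebraically closed field, $Q=\mathbb P^1_k\times\mathbb P^1_k$, and let $S=\bigoplus_{i,j\ge 0}H^0(Q,\mathcal O_Q(i,j))$ be the bigraded coordinate ring. A $(1,0)$-line (resp. $(0,1)$-line) is the zero locus of a nonzero form of bidegree $(1,0)$ (resp. $(0,1)$). For a zero-dimensional scheme $X\subset Q$ with saturated ideal $I(X)\subset S$, its Hilbert matrix is $M_X(i,j)=\dim_k (S/I(X))_{i,j}$ (equal to $0$ if $i<0$ or $j<0$). **Admissible matrices.** For a matrix $M=(m_{ij})_{i,j\in\mathbb Z}$ of integers with $m_{ij}=0$ for $i<0$ or $j<0$, put $\Delta M=(c_{ij})$ with $c_{ij}=m_{ij}-m_{i-1\,j}-m_{i\,j-1}+m_{i-1\,j-1}$, and $a_{ij}=m_{ij}-m_{i\,j-1}=\sum_{t=0}^i c_{tj}$, $b_{ij}=m_{ij}-m_{i-1\,j}=\sum_{t=0}^j c_{it}$. $M$ is admissible if, for indices in $\mathbb N$ (with $0\in\mathbb N$): (1) $c_{ij}\le 1$, and $c_{ij}=0$ for $i\gg0$ or $j\gg 0$; (2) if $c_{ij}\le 0$ then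 $c_{rs}\le 0$ for all $r\ge i$, $s\ge j$; (3) $0\le \sum_{t=0}^j c_{it}$ and $0\le\sum_{t=0}^i c_{tj}$ for all $i,j\ge0$; $\sum_{t=0}^j c_{it}\le\sum_{t=0}^j c_{i-1\,t}$ for all $i\ge1$, $j\ge 0$; and $\sum_{t=0}^i c_{tj}\le\sum_{t=0}^i c_{t\,j-1}$ for all $i\ge 0$, $j\ge1$. $M$ is of size $(a,b)$ if $a+1=\min\{i\in\mathbb N: c_{i0}=0\}$ and $b+1=\min\{j\in\mathbb N: c_{0j}=0\}$ (then $\Delta M$ vanishes outside the rectangle with opposite vertices $(0,0)$ and $(a,b)$). Let $T=\{(i,j)\in\mathbb N\times\mathbb N: c_{ij}<0\}$ and, for $(i,j)\in T$, $I_{ij}=\{0,\dots,-c_{ij}-1\}$. **Plain.** An admissible $M$ is plain if the pairs $(a_{ij}+r,b_{ij}+r)$ are pairwise distinct: for any $(i_1,j_1)\neq(i_2,j_2)$ in $T$, $r_1\in I_{i_1j_1}$, $r_2\in I_{i_2j_2}$, one has $(a_{i_1j_1}+r_1,b_{i_1j_1}+r_1)\neq(a_{i_2j_2}+r_2,b_{i_2j_2}+r_2)$. **$\Delta$-regular.** An admissible $M$ is $\Delta$-regular if for any $(i_1,j_1),\dots,(i_n,j_n)\in T$ and $r_1\in I_{i_1j_1},\dots,r_n\in I_{i_nj_n}$: (1) if $a_{i_1j_1}+r_1=\dots=a_{i_nj_n}+r_n$, $i_1,\dots,i_n$ are distinct and $j_1<\dots<j_n$, then $b_{i_1j_1}+r_1\le\dots\le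 b_{i_nj_n}+r_n$; (2) if $b_{i_1j_1}+r_1=\dots=b_{i_nj_n}+r_n$, $j_1,\dots,j_n$ are distinct and $i_1<\dots<i_n$, then $a_{i_1j_1}+r_1\le\dots\le a_{i_nj_n}+r_n$. **Zero-dimensional scheme associated to $M$.** Let $R_0,\dots,R_a$ be arbitrary pairwise distinct $(1,0)$-lines and $C_0,\dots,C_b$ arbitrary pairwise distinct $(0,1)$-lines, $P_{ij}=R_i\cap C_j$, and let $X=\{P_{ij}: c_{ij}=1\}$ (reduced). Put $\mathcal P=\{P_{a_{ij}+r,\,b_{ij}+r}: (i,j)\in T,\ r\in I_{ij}\}$, which is a subset of $X$. The reduced scheme $Z=X\setminus\mathcal P$ is called the zero-dimensional scheme associated to $M$. *)

(* Defs.v *)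
From mathcomp Require Import all_boot all_order all_algebra.
From mathcomp Require Import boolp classical_sets.
From mathcomp Require Import mpoly.
From mathcomp Require Import ring zify.

Set Implicit Arguments.
Unset Strict Implicit.
Unset Printing Implicit Defensive.

Import Order.TTheory GRing.Theory Num.Theory.
Local Open Scope classical_set_scope.
Local Open Scope ring_scope.

Section QuotientDimension.
Variables (F : fieldType) (E : lmodType F).
Implicit Types (V W : set E) (n : nat).

(* The classes of the e_i form a basis of V / W, for subspaces W <= V. *)
Definition quot_basis V W n (e : 'I_n -> E) : Prop :=
  (forall i, V (e i)) /\
  (forall f, V f -> exists! c : 'rV[F]_n, W (f - \sum_i c 0 i *: e i)).

(* dim (V / W), with value 0 when V / W is infinite-dimensional; see
   [quot_dimE] and [quot_basis_ex]. *)
Definition quot_dim V W : nat :=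
  xget 0%N [set n | exists e : 'I_n -> E, quot_basis V W e].

Definition subspace W : Prop :=
  W 0 /\ (forall (a : F) x y, W x -> W y -> W (a *: x + y)).

Lemma subspace_sum W n (c : 'I_n -> F) (x : 'I_n -> E) :
  subspace W -> (forall i, W (x i)) -> W (\sum_i c i *: x i).
Proof.
move=> [W0 WD] Wx; elim/big_ind: _ => // [u v Wu Wv|i _].
  by rewrite -[u]scale1r; apply: WD.
by rewrite -[_ *: _]addr0; apply: WD.
Qed.

Lemma subspaceD W x y : subspace W -> W x -> W y -> W (x + y).
Proof. by move=> [_ WD] Wx Wy; rewrite -[x]scale1r; apply: WD. Qed.

Lemma subspaceZ W (a : F) x : subspace W -> W x -> W (a *: x).
Proof. by move=> [W0 WD] Wx; rewrite -[_ *: _]addr0; apply: WD. Qed.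

Lemma subspaceI V W : subspace V -> subspace W -> subspace (V `&` W).
Proof.
move=> [V0 VD] [W0 WD]; split; first by split.
by move=> a x y [Vx Wx] [Vy Wy]; split; [apply: VD | apply: WD].
Qed.

Let indep W n (e : 'I_n -> E) :=
  forall c : 'rV[F]_n, W (\sum_i c 0 i *: e i) -> c = 0.

Let spans V W n (e : 'I_n -> E) :=
  forall f, V f -> exists c : 'rV[F]_n, W (f - \sum_i c 0 i *: e i).

Let indep_leq V W n m (e : 'I_n -> E) (g : 'I_m -> E) :
  subspace W -> (forall i, V (e i)) -> indep W e -> spans V W g -> (n <= m)%N.
Proof.
move=> sW Ve Ie Sg; rewrite leqNgt; apply/negP => mn.
have /choice[A WA] i : exists c : 'rV[F]_m, W (e i - \sum_j c 0 j *: g j).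
  exact: Sg.
pose B := \matrix_(i < n) A i.
have : kermx B != 0.
  rewrite -mxrank_eq0 mxrank_ker subn_eq0 -ltnNge.
  exact: leq_ltn_trans (rank_leq_col B) mn.
case/rowV0Pn => c /sub_kermxP cB0 /negP; apply; apply/eqP/Ie.
suff -> : \sum_i c 0 i *: e i =
          \sum_i c 0 i *: (e i - \sum_j A i 0 j *: g j).
  exact: subspace_sum.
under [RHS]eq_bigr do rewrite scalerBr scaler_sumr.
rewrite sumrB exchange_big /= [X in _ - X]big1 ?subr0// => j _.
under eq_bigr do rewrite scalerA.
have cAj : \sum_i c 0 i * A i 0 j = 0.
  transitivity ((c *m B) 0 j); last by rewrite cB0 mxE.
  by rewrite mxE; apply: eq_bigr => i _; rewrite !mxE.
by rewrite -scaler_suml cAj scale0r.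
Qed.

Let quot_basisP V W n (e : 'I_n -> E) : subspace V -> subspace W ->
  quot_basis V W e <-> [/\ forall i, V (e i), indep W e & spans V W e].
Proof.
move=> sV sW; split=> [[Ve Be]|[Ve Ie Se]]; last first.
  split=> // f /Se[c Wc]; exists c; split=> // d Wd.
  apply/eqP; rewrite -subr_eq0; apply/eqP/Ie.
  have := subspaceD sW (subspaceZ (-1) sW Wc) Wd.
  rewrite scaleN1r opprB addrA subrK -sumrB; congr W; apply: eq_bigr => i _.
  by rewrite !mxE -scalerBl.
split=> // [c Wc|f /Be[c []]]; last by exists c.
have [d [_ dU]] := Be 0 sV.1.
have d0 : d = 0.
  by apply: dU; rewrite big1 ?subr0 => [|i _]; [case: sW|rewrite mxE scale0r].
apply/oppr_inj; rewrite oppr0 -d0; apply/esym/dU.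
rewrite sub0r -sumrN; congr W: Wc.
by apply: eq_bigr => i _; rewrite !mxE scaleNr opprK.
Qed.

Lemma quot_dimE V W n (e : 'I_n -> E) :
  subspace V -> subspace W -> quot_basis V W e -> quot_dim V W = n.
Proof.
move=> sV sW Be; rewrite /quot_dim; 
case: xgetP => [m _ [g Bg]|/(_ n)[]]; last by exists e.
have [Ve Ie Se] := (quot_basisP e sV sW).1 Be.
have [Vg Ig Sg] := (quot_basisP g sV sW).1 Bg.
by apply/eqP; rewrite eqn_leq (indep_leq sW Vg Ig Se) (indep_leq sW Ve Ie Sg).
Qed.

Lemma quot_basis_ex V W m (g : 'I_m -> E) :
    subspace V -> subspace W ->
    (forall f, V f -> exists c : 'rV[F]_m, f = \sum_i c 0 i *: g i) ->
  exists e : 'I_(quot_dim V W) -> E, quot_basis V W e.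
Proof.
move=> sV sW genV.
suff [n [e Be]] : exists n, exists e : 'I_n -> E, quot_basis V W e.
  by rewrite (quot_dimE sV sW Be); exists e.
have Sg : spans V W g.
  by move=> f /genV[c ->]; exists c; rewrite subrr; case: sW.
pose P n := `[< exists e : 'I_n -> E, (forall i, V (e i)) /\ indep W e >].
have exP : exists n, P n.
  exists 0%N; apply/asboolP; exists (fun=> 0); split=> [[]//|c _].
  by apply/rowP => -[].
have leP n : P n -> (n <= m)%N.
  by move=> /asboolP[e [Ve Ie]]; apply: indep_leq Ie Sg.
case: (ex_maxnP exP leP) => n /asboolP[e [Ve Ie]] maxn.
exists n, e; apply/quot_basisP => //; split=> // f Vf.
pose e' (i : 'I_(1 + n)) := if split i is inr j then e j else f.
have [c [Wc c0]] : exists c : 'rV[F]_(1 + n),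
    W (\sum_i c 0 i *: e' i) /\ c <> 0.
  apply: contrapT => nc; suff /maxn : P (1 + n)%N by rewrite ltnn.
  apply/asboolP; exists e'; split=> [i|c Wc].
    by rewrite /e'; case: split.
  by apply: contrapT => c0; apply: nc; exists c.
have {Wc} : W (c 0 (lshift n 0) *: f + \sum_i c 0 (rshift 1 i) *: e i).
  congr W: Wc; rewrite big_split_ord big_ord1 /e' /=.
  congr (_ *: _ + _); first by case: splitP => // j; case: j => [[]].
  apply: eq_bigr => i _; congr (_ *: _).
  by rewrite (unsplitK (inr i : 'I_1 + 'I_n)).
set a := c 0 _ => Wc.
have [a0|a_neq0] := eqVneq a 0.
  case: c0; apply/rowP => i; rewrite mxE -(splitK i).
  case: (split i) => j /=; first by rewrite ord1.
  have /rowP/(_ j) : \row_l c 0 (rshift 1 l) = 0; last by rewrite !mxE.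
  apply: Ie; move: Wc; rewrite a0 scale0r add0r; congr W.
  by apply: eq_bigr => l _; rewrite mxE.
exists (\row_i - (a^-1 * c 0 (rshift 1 i))).
have := subspaceZ a^-1 sW Wc; congr W.
rewrite scalerDr scalerA mulVf// scale1r; congr (_ + _).
rewrite scaler_sumr -sumrN; apply: eq_bigr => i _.
by rewrite mxE scaleNr opprK scalerA.
Qed.

End QuotientDimension.

Section Quadric.
Variable k : closedFieldType.

(* A point of P^1 is a line through the origin of k^2. *)
Definition P1 : Type := {L : {vspace 'rV[k]_2} | \dim L == 1%N}.
Definition quadric : Type := (P1 * P1)%type.

(* The bigraded ring S = k[x_0, x_1, y_0, y_1]: the variables indexed by
   [lshift 2 _] are the x's and those indexed by [rshift 2 _] the y's. *)
Definition coord_ring := {mpoly k[2 + 2]}.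

Definition bidegree (m : 'X_{1.. 2 + 2}) : nat * nat :=
  (\sum_(l < 2) m (lshift 2 l), \sum_(l < 2) m (rshift 2 l))%N.

(* The component S_d of bidegree d, that is, H^0(Q, O(d.1, d.2)). *)
Definition bihomog (d : nat * nat) : set coord_ring :=
  [set f | forall m, m \in msupp f -> bidegree m = d].

(* f vanishes at all the bihomogeneous coordinates (u, v) of p. *)
Definition vanishes (f : coord_ring) (p : quadric) : Prop :=
  forall u v : 'rV[k]_2, u != 0 -> u \in sval p.1 ->
    v != 0 -> v \in sval p.2 -> f.@[fun l => row_mx u v 0 l] = 0.

Definition zero_locus (f : coord_ring) : set quadric := [set p | vanishes f p].

Definition is_line (d : nat * nat) (L : set quadric) : Prop :=
  exists f : coord_ring, [/\ f != 0, bihomog d f & L = zero_locus f].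

(* A reduced zero-dimensional subscheme of Q is given by its set Z of points;
   its saturated ideal consists of the f vanishing on Z. As k is infinite, f
   vanishes at all bihomogeneous coordinates of a point if and only if each of
   its bihomogeneous components does, so that this ideal is bihomogeneous. *)
Definition ideal_of (Z : set quadric) : set coord_ring :=
  [set f | forall p, Z p -> vanishes f p].

Definition hilbert_matrix (Z : set quadric) (i j : int) : int :=
  match i, j with
  | Posz m, Posz n =>
      Posz (quot_dim (bihomog (m, n)) (ideal_of Z `&` bihomog (m, n)))
  | _, _ => 0
  end.

Lemma subspace_bihomog d : subspace (bihomog d).
Proof.
split=> [m|a f g Sf Sg m]; first by rewrite msupp0.
by move=> /msuppD_le; rewrite mem_cat => /orP[/msuppZ_le/Sf|/Sg].
Qed.

Lemma subspace_ideal_of Z : subspace (ideal_of Z).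
Proof.
split=> [p Zp u v *|a f g If Ig p Zp u v u0 Lu v0 Lv]; first by rewrite meval0.
by rewrite mevalD mevalZ (If p Zp u v)// (Ig p Zp u v)// mulr0 addr0.
Qed.

Lemma quot_basis_hilbert (Z : set quadric) d :
  let W := ideal_of Z `&` bihomog d in
  exists e : 'I_(quot_dim (bihomog d) W) -> coord_ring, quot_basis (bihomog d) W e.
Proof.
move=> W; pose B : finType := bmultinom (2 + 2) (d.1 + d.2).+1.
pose g (i : 'I_#|B|) : coord_ring := 'X_[bmnm (enum_val i : B)].
apply: (quot_basis_ex (g := g)).
- exact: subspace_bihomog.
- exact: subspaceI (subspace_ideal_of Z) (subspace_bihomog d).
move=> f Sf; exists (\row_l f@_(enum_val l : B)).
rewrite [LHS](@mpolywE _ _ (d.1 + d.2).+1).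
  rewrite (reindex (@enum_val B predT)) /=; last exact/onW_bij/enum_val_bij.
  by apply: eq_bigr => l _; rewrite mxE.
rewrite msizeE big_seq; apply/bigmax_leqP_seq => m mf _.
by rewrite ltnS mdegE big_split_ord -(Sf m mf).
Qed.

End Quadric.

Section AdmissibleMatrices.
Implicit Types (M : int -> int -> int) (i j r : nat) (a b : int).

Definition Delta M (i j : int) : int :=
  M i j - M (i - 1) j - M i (j - 1) + M (i - 1) (j - 1).
Definition amat M (i j : int) : int := M i j - M i (j - 1).
Definition bmat M (i j : int) : int := M i j - M (i - 1) j.

Definition admissible M : Prop :=
  [/\ forall i j : int, (i < 0) || (j < 0) -> M i j = 0,
      (forall i j, Delta M i j <= 1) /\
      (exists N, forall i j, (N <= i)%N || (N <= j)%N -> Delta M i j = 0),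
      forall i j, Delta M i j <= 0 ->
        forall r s : nat, (i <= r)%N -> (j <= s)%N -> Delta M r s <= 0
    & [/\ forall i j, 0 <= \sum_(t < j.+1) Delta M i t,
          forall i j, 0 <= \sum_(t < i.+1) Delta M t j,
          forall i j, (1 <= i)%N ->
            \sum_(t < j.+1) Delta M i t <= \sum_(t < j.+1) Delta M i.-1 t
        & forall i j, (1 <= j)%N ->
            \sum_(t < i.+1) Delta M t j <= \sum_(t < i.+1) Delta M t j.-1]].

Lemma amatE M i j : admissible M -> amat M i j = \sum_(t < i.+1) Delta M t j.
Proof.
case=> M0 _ _ _; elim: i => [|i IH]; last first.
  rewrite big_ord_recr -IH /amat /Delta /=.
  by rewrite (_ : i.+1%:Z - 1 = i); [ring|lia].
by rewrite big_ord1 /amat /Delta !(M0 (0 - 1))// ?subr0 ?addr0.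
Qed.

Lemma bmatE M i j : admissible M -> bmat M i j = \sum_(t < j.+1) Delta M i t.
Proof.
case=> M0 _ _ _; elim: j => [|j IH]; last first.
  rewrite big_ord_recr -IH /bmat /Delta /=.
  by rewrite (_ : j.+1%:Z - 1 = j); [ring|lia].
by rewrite big_ord1 /bmat /Delta !(M0 _ (0 - 1)) ?orbT// subr0 addr0.
Qed.

Definition is_min (P : nat -> Prop) (n : nat) : Prop :=
  P n /\ forall m, P m -> (n <= m)%N.

(* The zero matrix has size (-1, -1). *)
Definition of_size M a b : Prop :=
  exists m n, [/\ a + 1 = m%:Z, is_min (fun i => Delta M i 0 = 0) m,
                  b + 1 = n%:Z & is_min (fun j => Delta M 0 j = 0) n].

(* (i, j) is in T and r is in I_ij. *)
Definition in_TI M i j r : Prop := Delta M i j < 0 /\ r%:Z < - Delta M i j.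

Definition plain M : Prop :=
  forall i1 j1 r1 i2 j2 r2, in_TI M i1 j1 r1 -> in_TI M i2 j2 r2 ->
    (i1, j1) <> (i2, j2) ->
    (amat M i1 j1 + r1, bmat M i1 j1 + r1) <>
    (amat M i2 j2 + r2, bmat M i2 j2 + r2).

Definition Delta_regular M : Prop :=
  forall (n : nat) (i j r : 'I_n -> nat),
    (forall s, in_TI M (i s) (j s) (r s)) ->
    let ar s := amat M (i s) (j s) + r s in
    let br s := bmat M (i s) (j s) + r s in
    ((forall s t, ar s = ar t) -> injective i ->
       {homo j : s t / (s < t)%N} -> {homo br : s t / (s <= t)%N >-> s <= t}) /\
    ((forall s t, br s = br t) -> injective j ->
       {homo i : s t / (s < t)%N} -> {homo ar : s t / (s <= t)%N >-> s <= t}).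

Variable k : closedFieldType.

(* Z is the set of points of a scheme associated to M, of size (a, b); the
   lines R i and C j matter only for 0 <= i <= a and 0 <= j <= b. *)
Definition associated M a b (Z : set (quadric k)) : Prop :=
  exists R C : int -> set (quadric k),
  [/\ (forall i : int, 0 <= i <= a -> is_line (1, 0)%N (R i)) /\
      (forall i i' : int, 0 <= i <= a -> 0 <= i' <= a -> i <> i' -> R i <> R i'),
      (forall j : int, 0 <= j <= b -> is_line (0, 1)%N (C j)) /\
      (forall j j' : int, 0 <= j <= b -> 0 <= j' <= b -> j <> j' -> C j <> C j')
    & let P (i j : int) := R i `&` C j in
      let X := [set p | exists i j : nat, Delta M i j = 1 /\ P i j p] in
      let D := [set p | exists i j r : nat, in_TI M i j r /\
                          P (amat M i j + r) (bmat M i j + r) p] in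
      Z = X `\` D].

End AdmissibleMatrices.

(* Main.v *)
From HB Require Import structures.
Require Import Defs.
From mathcomp Require Import all_boot all_order all_algebra.
From mathcomp Require Import boolp classical_sets.
From mathcomp Require Import mpoly.
From mathcomp Require Import ring zify.

(** Let c = Delta M, let X be the Ferrers diagram of the cells with c = 1, and
    let one mark (s, t, r) stand for each unit of a negative entry c_st; it
    removes the cell (a_st + r, b_st + r) from X. Summing c shows that
    M(i,j) = #(X inter R) - N, where R is the rectangle [0,i] x [0,j] and N is
    the number of marks with s <= i and t <= j. So the theorem says that each
    mark lowers the Hilbert function of X by one, exactly in the bidegrees
    (i,j) >= (s,t).

    Linear algebra. Evaluating a form of bidegree (i,j) at the point P_xy is
    pairing its coefficient matrix with the rank one matrix
    e_xy = phi_x^T psi_y, where phi_x and psi_y list the monomials of degrees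
    i and j at R_x and C_y. Hence M_Z(i,j) is the dimension of the span of the
    e_xy over the cells (x,y) of Z ([hilbert_dim]). The geometry enters only
    through general position: at most i+1 of the phi_x, or j+1 of the psi_y,
    are linearly independent, because products of linear forms separate points
    of the projective line. Consequently i+1 cells of a column span all the
    cells of that column, j+1 cells of a row span the row ([tensor_column],
    [tensor_row]), and the e_xy with (x,y) in R are independent
    ([tensor_free]).

    Combinatorics. For fixed t the marks use distinct rows, for fixed s distinct
    columns, and the s of the marks in a given column fill an interval that ends
    at the height of that column ([mark_exists], [mark_unique]). The two
    conditions of the theorem are exchanged by transposition, so let
    a_ij >= a_(i-1)(j+1). Then two marks of one row with t < t' satisfy s' < s,
    so that Delta-regularity and plainness put the second one strictly to the
    right of the first ([row_strict]). This propagates to different rows: a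
    mark that is weakly below another one and has a larger t lies strictly to
    its right ([later_mark_right]).

    Lower bound. The cells of Z and the N cells removed by the marks with
    s <= i, t <= j span every e_xy with (x,y) in X, whence
    M_Z(i,j) + N >= #(X inter R) ([dim_lower]). Indeed, run through the marks
    column by column and by increasing s inside a column. When the mark
    (s, t, r) is reached, at least s other cells of its column and t other
    cells of its row have already been obtained, so its own cell follows if
    s > i or t > j ([antidiagonal_capturing]).

    Upper bound. For a suitable corner (p,q), put Q = {x >= p, y >= q}. The
    cells of R outside Q belong to X, and every cell outside Q is spanned by
    cells of R outside Q, so that M_Z(i,j) <= #(R - Q) + #(Z inter Q). The
    corner is chosen such that Q contains the N marked cells, and, for each
    cell of X inter Q outside R, one further marked cell
    ([antidiagonal_balanced]). Counting the marked cells in Q turns the bound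
    into M_Z(i,j) <= #(X inter R) - N ([dim_upper]). *)

Set Implicit Arguments.
Unset Strict Implicit.
Unset Printing Implicit Defensive.
Import Order.TTheory GRing.Theory Num.Theory.

(** * Staircases and their marks *)

Definition transp (T : Type) (f : nat -> nat -> T) i j := f j i.

(** The matrix Delta M of an admissible M with its partial sums along columns
    (a) and rows (b). Their nonnegativity is built into the type nat, and the
    axioms form a family stable under transposition. *)
Record staircase (c : nat -> nat -> int) (a b : nat -> nat -> nat) : Prop :=
  Staircase {
    stair_le1 : forall i j, (c i j <= 1)%R;
    stair_mono : forall i j i' j', (c i j <= 0)%R -> i <= i' -> j <= j' -> (c i' j' <= 0)%R;
    stair_a0 : forall j, Posz (a 0 j) = c 0 j;
    stair_aS : forall i j, Posz (a i.+1 j) = (Posz (a i j) + c i.+1 j)%R;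
    stair_b0 : forall i, Posz (b i 0) = c i 0;
    stair_bS : forall i j, Posz (b i j.+1) = (Posz (b i j) + c i j.+1)%R;
    stair_a_anti : forall i j, a i j.+1 <= a i j;
    stair_b_anti : forall i j, b i.+1 j <= b i j;
    stair_fin : exists K, forall i j, (K <= i) || (K <= j) -> c i j = 0%R
  }.

Lemma staircase_transp c a b :
  staircase c a b -> staircase (transp c) (transp b) (transp a).
Proof.
case=> c1 cm a0 aS b0 bS aa ba [K cK]; split; rewrite /transp //.
- by move=> i j i' j' cij ii jj; apply: cm cij jj ii.
- by exists K => i j; rewrite orbC; apply: cK.
Qed.

(** A mark (s, t, r) is stored as ((s, t), r), so that s, t and r are e.1.1,
    e.1.2 and e.2. *)
Definition mark := (nat * nat * nat)%type.
Definition swap_mark (e : mark) : mark := (e.1.2, e.1.1, e.2).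
Definition is_mark (c : nat -> nat -> int) (e : mark) : Prop :=
  (Posz e.2 < - c e.1.1 e.1.2)%R.
Definition mrow (a : nat -> nat -> nat) (e : mark) : nat := a e.1.1 e.1.2 + e.2.
Definition mcol (b : nat -> nat -> nat) (e : mark) : nat := b e.1.1 e.1.2 + e.2.

Section Staircase.
Variables (c : nat -> nat -> int) (a b : nat -> nat -> nat).
Hypothesis st : staircase c a b.

(** To the right of a nonpositive entry, all the entries are nonpositive. *)
Lemma b_decreasing t t' s : (c s t <= 0)%R -> t <= t' -> b s t' <= b s t.
Proof.
move=> cst; elim: t' => [|t' IH]; first by case: t cst.
rewrite leq_eqVlt => /orP[/eqP<- //|tt']; apply: leq_trans (IH tt').
have := stair_bS st s t'; have := stair_mono st cst (leqnn s) (leqW tt').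
lia.
Qed.

Lemma b_bound s t : b s t <= t.+1.
Proof.
elim: t => [|t IH].
  have := stair_b0 st s; have := stair_le1 st s 0; lia.
have := stair_bS st s t; have := stair_le1 st s t.+1; lia.
Qed.

Lemma b_full s t : c s t = 1%R -> b s t = t.+1.
Proof.
have c1 t' : t' <= t -> c s t = 1%R -> c s t' = 1%R.
  move=> tt cst; have := stair_le1 st s t'; have := @stair_mono _ _ _ st s t' s t.
  rewrite cst; lia.
elim: t c1 => [|t IH] c1 cst.
  have := stair_b0 st s; lia.
have := stair_bS st s t; rewrite IH//.
- lia.
- move=> t' tt' ?; apply: c1 => //; lia.
- by apply: c1.
Qed.

(** The partial sum along row s is at most t before column t, since c <= 1, and
    it cannot grow afterwards. *)
Lemma b_capped s t t' : (c s t <= 0)%R -> b s t' <= t.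
Proof.
move=> cst; have [tt'|tt'] := leqP t t'; last exact: leq_trans (b_bound _ _) tt'.
apply: leq_trans (b_decreasing cst tt') _.
case: t cst {tt'} => [|t] cst.
  have := stair_b0 st s; lia.
have := stair_bS st s t; have := b_bound s t; lia.
Qed.

Lemma b_antitone s s' t : s <= s' -> b s' t <= b s t.
Proof.
elim: s' => [|s' IH]; first by case: s.
rewrite leq_eqVlt => /orP[/eqP<- //|ss']; apply: leq_trans (IH ss').
exact: (stair_b_anti st).
Qed.

Lemma c_down i j i' j' : c i j = 1%R -> i' <= i -> j' <= j -> c i' j' = 1%R.
Proof.
move=> cij ii jj; have := stair_le1 st i' j'.
have := @stair_mono _ _ _ st i' j' i j; rewrite cij; lia.
Qed.

Lemma c_one_or_le0 i j : c i j = 1%R \/ (c i j <= 0)%R.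
Proof. have := stair_le1 st i j; lia. Qed.

Lemma mark_neg e : is_mark c e -> (c e.1.1 e.1.2 < 0)%R.
Proof. rewrite /is_mark; lia. Qed.

(** The marks at (s, t.+1) occupy the columns from b_s(t+1) to b_st - 1: the
    successive blocks of marks of one s use up columns from right to left. *)
Lemma mark_prev e : is_mark c e ->
  exists2 t, e.1.2 = t.+1 & mcol b e < b e.1.1 t.
Proof.
case: e => -[s t] r; rewrite /is_mark /mcol /= => d.
case: t d => [|t] d; first by have := stair_b0 st s; lia.
exists t => //; have := stair_bS st s t; lia.
Qed.

Lemma mark_col_in e : is_mark c e -> c e.1.1 (mcol b e) = 1%R.
Proof.
move=> d; have [t _ lt] := mark_prev d.
case: (c_one_or_le0 e.1.1 (mcol b e)) => // c0; have := b_capped t c0; lia.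
Qed.

(** By [mark_prev], the block of e' ends left of b_s(t'-1), hence left of the
    block of e, which starts at b_st. *)
Lemma mcol_decreasing e e' : is_mark c e -> is_mark c e' -> e.1.1 = e'.1.1 ->
  e.1.2 < e'.1.2 -> mcol b e' < mcol b e.
Proof.
move=> d d' ss tt; have [t te lt] := mark_prev d'.
apply: leq_trans lt _; rewrite -ss.
have : t >= e.1.2 by lia.
move/(b_decreasing (ltW (mark_neg d))) => /leq_trans; apply; exact: leq_addr.
Qed.

Lemma mark_unique e e' : is_mark c e -> is_mark c e' -> e.1.1 = e'.1.1 ->
  mcol b e = mcol b e' -> e = e'.
Proof.
move=> d d' ss cc; have [tt|tt|tt] := ltngtP e.1.2 e'.1.2.
- have := mcol_decreasing d d' ss tt; lia.
- have := mcol_decreasing d' d (esym ss) tt; lia.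
case: e e' {d d'} ss cc tt => [[s t] r] [[s' t'] r'] /= -> + tt.
by rewrite /mcol /= tt => /addnI ->.
Qed.

(** The partial sums b_sy, b_s(y+1), ... start above y when c_sy = 1, and they have
    come down to at most y at the column of M holding e; where they cross y there
    is a mark for column y. *)
Lemma mark_exists e s y : is_mark c e -> mcol b e <= y -> e.1.1 <= s ->
  c s y = 1%R ->
  exists e', [/\ is_mark c e', e'.1.1 = s, mcol b e' = y & e'.1.2 <= e.1.2].
Proof.
move=> d ey es csy.
have le_b : b s e.1.2 <= y.
  apply: leq_trans (b_antitone _ es) _; apply: leq_trans ey; exact: leq_addr.
have ex : exists t, (y <= t) && (b s t <= y).
  exists e.1.2; rewrite le_b andbT leqNgt; apply/negP => ty.
  have cst := c_down csy (leqnn s) (ltnW ty).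
  by move: (stair_mono st (ltW (mark_neg d)) es (leqnn _)); rewrite cst.
have yt : y <= e.1.2.
  rewrite leqNgt; apply/negP => ty.
  have cst := c_down csy (leqnn s) (ltnW ty).
  by move: (stair_mono st (ltW (mark_neg d)) es (leqnn _)); rewrite cst.
case: (ex_minnP ex) => t /andP[yt' bt] mint.
have te : t <= e.1.2 by apply: mint; rewrite yt.
case: t yt' bt mint te => [|t] yt' bt mint te.
  have y0 : y = 0 by lia.
  by move: bt; rewrite y0 b_full // -[X in c s X]y0.
have lt : y < b s t.
  rewrite ltnNge; apply/negP => bty.
  have [yt2|ty] := leqP y t; first by have := mint t; rewrite yt2 bty ltnn => /(_ isT).
  have yE : y = t.+1 by lia.
  by move: bt; rewrite -yE b_full // ltnn.
exists (s, t.+1, y - b s t.+1); split => //.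
- rewrite /is_mark /=; have := stair_bS st s t; lia.
- rewrite /mcol /=; lia.
Qed.

(** The mark with the s of e' found in the column of e' by [mark_exists] has its t
    bounded by that of e; by uniqueness it is e' itself. *)
Lemma mark_anti e e' : is_mark c e -> is_mark c e' -> mcol b e <= mcol b e' ->
  e.1.1 <= e'.1.1 -> e'.1.2 <= e.1.2.
Proof.
move=> d d' cc ss.
have [e2 [d2 s2 c2 t2]] := mark_exists d cc ss (mark_col_in d').
by rewrite (mark_unique d' d2 (esym s2) (esym c2)).
Qed.

(** Different marks of one column have different s, and these lie below the height
    of the column. So at most (height - s) cells are removed by marks whose s
    is at least that of e, and at least s cells are left. *)
Lemma unblocked_column e : is_mark c e -> exists S : seq nat,
  [/\ uniq S, size S = e.1.1 & forall x, x \in S -> c x (mcol b e) = 1%R /\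
    forall e', is_mark c e' -> mrow a e' = x -> mcol b e' = mcol b e -> e'.1.1 < e.1.1].
Proof.
move=> d; have [K cK] := stair_fin st; set y := mcol b e; set s := e.1.1.
pose XX := [seq x <- iota 0 K | c x y == 1%R].
pose bad x := `[< exists e', [/\ is_mark c e', mrow a e' = x, mcol b e' = y & s <= e'.1.1] >].
have memXX x : (x \in XX) = (c x y == 1%R).
  rewrite mem_filter mem_iota add0n /=; case: eqP => //= cxy.
  by rewrite ltnNge; apply/negP => Kx; move: cxy; rewrite cK ?Kx.
have /choice[g gP] x : exists e', bad x ->
    [/\ is_mark c e', mrow a e' = x, mcol b e' = y & s <= e'.1.1].
  by case: (boolP (bad x)) => [/asboolP[e' ?]|_]; [exists e'|exists e].
have le_bad : size [seq x <- XX | bad x] <= size [seq x <- XX | s <= x].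
  rewrite -(size_map (fun x => (g x).1.1)); apply: uniq_leq_size.
    rewrite map_inj_in_uniq ?filter_uniq ?iota_uniq // => x x'.
    rewrite !mem_filter => /andP[/gP[d1 r1 c1 _] _] /andP[/gP[d2 r2 c2 _] _] ss.
    by rewrite -r1 -r2 (mark_unique d1 d2 ss) // c1.
  move=> _ /mapP[x + ->]; rewrite mem_filter => /andP[/gP[d1 r1 c1 s1] _].
  by rewrite mem_filter s1 memXX -c1 mark_col_in /=.
have size_low : size [seq x <- XX | ~~ (s <= x)] = s.
  rewrite -[RHS](size_iota 0); apply/perm_size/uniq_perm; rewrite ?filter_uniq ?iota_uniq //.
  move=> x; rewrite mem_iota mem_filter memXX add0n leq0n /= -ltnNge.
  case: ltnP => //= xs; apply/eqP; exact: c_down (mark_col_in d) (ltnW xs) (leqnn _).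
have le_good : s <= size [seq x <- XX | ~~ bad x].
  have cb : count bad XX + count (fun x => ~~ bad x) XX = size XX := count_predC bad XX.
  have cs : count (fun x => s <= x) XX + count (fun x => ~~ (s <= x)) XX = size XX.
    exact: (count_predC (fun x => s <= x) XX).
  move: le_bad size_low cb cs; rewrite !(@size_filter _ _ XX).
  move: (count bad XX) (count _ XX) (count _ XX) (count _ XX) => *. lia.
exists (take s [seq x <- XX | ~~ bad x]); split.
- by rewrite take_uniq // !filter_uniq ?iota_uniq.
- by rewrite size_takel.
move=> x /mem_take; rewrite mem_filter memXX => /andP[nb /eqP cx]; split=> //.
move=> e' d' r' c'; rewrite ltnNge; apply/negP => se.
by move/negP: nb; apply; apply/asboolP; exists e'.
Qed.

End Staircase.

Record regular (c : nat -> nat -> int) (a b : nat -> nat -> nat) : Prop :=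
  Regular {
    reg_plain : forall e e', is_mark c e -> is_mark c e' ->
      mrow a e = mrow a e' -> mcol b e = mcol b e' -> e = e';
    reg_row : forall e e', is_mark c e -> is_mark c e' -> mrow a e = mrow a e' ->
      e.1.1 <> e'.1.1 -> e.1.2 < e'.1.2 -> mcol b e <= mcol b e';
    reg_col : forall e e', is_mark c e -> is_mark c e' -> mcol b e = mcol b e' ->
      e.1.2 <> e'.1.2 -> e.1.1 < e'.1.1 -> mrow a e <= mrow a e'
  }.

Lemma swap_markK : involutive swap_mark. Proof. by case=> -[]. Qed.

Lemma regular_transp c a b :
  regular c a b -> regular (transp c) (transp b) (transp a).
Proof.
case=> pl rr rc; split=> e e' d d'.
- by move=> re ce; apply: (can_inj swap_markK); apply: pl.
- exact: (rc (swap_mark e) (swap_mark e') d d').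
- exact: (rr (swap_mark e) (swap_mark e') d d').
Qed.

Definition removed c a b x y :=
  exists e, [/\ is_mark c e, mrow a e = x & mcol b e = y].

(** What the span of a set of evaluation vectors satisfies in bidegree (i, j): a
    column meeting it in i+1 cells is contained in it, and so is a row meeting it
    in j+1 cells. *)
Definition spreading (c : nat -> nat -> int) i j (U : nat -> nat -> Prop) :=
  (forall y S, uniq S -> size S = i.+1 ->
    (forall x, x \in S -> c x y = 1%R /\ U x y) ->
    forall x, c x y = 1%R -> U x y) /\
  (forall x S, uniq S -> size S = j.+1 ->
    (forall y, y \in S -> c x y = 1%R /\ U x y) ->
    forall y, c x y = 1%R -> U x y).

(** The combinatorial content of the lower bound for the Hilbert function. *)
Definition capturing c a b := forall i j (U : nat -> nat -> Prop),
  spreading c i j U ->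
  (forall x y, c x y = 1%R -> ~ removed c a b x y -> U x y) ->
  (forall e, is_mark c e -> e.1.1 <= i -> e.1.2 <= j -> U (mrow a e) (mcol b e)) ->
  forall x y, c x y = 1%R -> U x y.

Lemma removed_transp c a b x y :
  removed (transp c) (transp b) (transp a) x y <-> removed c a b y x.
Proof.
by split=> -[e [d r k]]; exists (swap_mark e).
Qed.

Lemma capturing_transp c a b :
  capturing (transp c) (transp b) (transp a) -> capturing c a b.
Proof.
move=> cap i j U [sc sr] nrem small x y cxy.
apply: (cap j i (transp U)) => //.
- by move=> x' y' cxy' nr; apply: nrem => // /removed_transp.
- by move=> e d ti sj; apply: (small (swap_mark e)).
Qed.

(** The combinatorial content of the upper bound: a corner (p, q) whose quadrant Q
    leaves out only cells of the diagram within the rectangle [0,i] x [0,j],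
    contains the cells of all marks with s <= i and t <= j, and compensates each
    diagram cell of Q outside the rectangle by its own marked cell of Q. *)
Definition balanced (c : nat -> nat -> int) (a b : nat -> nat -> nat) :=
  forall i j, (c i j <= 0)%R -> exists p q,
  [/\ forall x y, x <= i -> y <= j -> ~~ ((p <= x) && (q <= y)) -> c x y = 1%R,
      forall e, is_mark c e -> e.1.1 <= i -> e.1.2 <= j -> p <= mrow a e /\ q <= mcol b e,
      forall x y, c x y = 1%R -> p <= x -> q <= y -> i < x ->
        exists e, [/\ is_mark c e, e.1.1 = x, mcol b e = y, e.1.2 <= j & p <= mrow a e]
    & forall x y, c x y = 1%R -> p <= x -> q <= y -> j < y ->
        exists e, [/\ is_mark c e, e.1.2 = y, mrow a e = x, e.1.1 <= i & q <= mcol b e]].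

Lemma balanced_transp c a b :
  balanced (transp c) (transp b) (transp a) -> balanced c a b.
Proof.
move=> bal i j cij; have [q [p [RQ N S T]]] := bal j i cij.
exists p, q; split.
- by move=> x y xi yj nQ; apply: RQ => //; rewrite andbC.
- by move=> e d si tj; have [] := N (swap_mark e) d tj si.
- move=> x y cxy px qy ix.
  by have [e [d ee r s k]] := T y x cxy qy px ix; exists (swap_mark e).
- move=> x y cxy px qy jy.
  by have [e [d ee r s k]] := S y x cxy qy px jy; exists (swap_mark e).
Qed.

(** The antidiagonal condition below is the first of the two alternative hypotheses
    of the theorem, shifted by one in i so that all indices are natural numbers. *)
Section Antidiagonal.
Variables (c : nat -> nat -> int) (a b : nat -> nat -> nat).
Hypotheses (st : staircase c a b) (rg : regular c a b).
Hypothesis cond : forall i j, a i j.+1 <= a i.+1 j.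

Let st' : staircase (transp c) (transp b) (transp a) := staircase_transp st.

Lemma mark_row_in e : is_mark c e -> c (mrow a e) e.1.2 = 1%R.
Proof. exact: (mark_col_in st' (e := swap_mark e)). Qed.

Lemma mark_in_diagram e : is_mark c e -> c (mrow a e) (mcol b e) = 1%R.
Proof.
move=> d; have [t te lt] := mark_prev st d.
apply: (c_down st (mark_row_in d)) => //; rewrite te.
apply: leq_trans (ltnW lt) _; apply: leq_trans (b_bound st _ _) _; lia.
Qed.

Lemma mark_exists_row e x t : is_mark c e -> mrow a e <= x -> e.1.2 <= t ->
  c x t = 1%R ->
  exists e', [/\ is_mark c e', e'.1.2 = t, mrow a e' = x & e'.1.1 <= e.1.1].
Proof.
move=> d ex et cxt.
have [e' [d' t' r' s']] := mark_exists (e := swap_mark e) st' d ex et cxt.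
by exists (swap_mark e').
Qed.

Lemma mark_anti_row e e' : is_mark c e -> is_mark c e' -> mrow a e <= mrow a e' ->
  e.1.2 <= e'.1.2 -> e'.1.1 <= e.1.1.
Proof.
exact: (mark_anti st' (e := swap_mark e) (e' := swap_mark e')).
Qed.

(** By [mark_anti_row], s' <= s. As e and e' share a row, a_(s'-1)t' exceeds that row
    while a_st does not; if s' = s, the antidiagonal condition would bound the former
    by the latter. So s' < s, and Delta-regularity applies. *)
Lemma row_strict e e' : is_mark c e -> is_mark c e' -> mrow a e = mrow a e' ->
  e.1.2 < e'.1.2 -> e'.1.1 < e.1.1 /\ mcol b e < mcol b e'.
Proof.
move=> d d' rr tt.
have ss : e'.1.1 <= e.1.1 by apply: mark_anti_row; rewrite ?rr // ltnW.
have ns : e.1.1 <> e'.1.1.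
  move=> se; have [s' se' lt] := mark_prev st' (d' : is_mark (transp c) (swap_mark e')).
  move: lt se' se; rewrite /transp /= -[mcol _ _]/(mrow a e') => lt se' se.
  have a1 : a e.1.1 e.1.2 <= mrow a e' by rewrite -rr leq_addr.
  have a2 := cond s' e.1.2; rewrite -se' -se in a2.
  have a3 : a s' e'.1.2 <= a s' e.1.2.+1.
    have := @b_antitone _ _ _ st' e.1.2.+1 e'.1.2 s' tt.
    by rewrite /transp.
  lia.
split; first by rewrite ltn_neqAle ss andbT; apply/eqP => /esym.
rewrite ltn_neqAle (reg_row rg) // andbT; apply/eqP => cc.
by move: tt; rewrite (reg_plain rg d d') // ltnn.
Qed.

Lemma col_strict e e' : is_mark c e -> is_mark c e' -> mcol b e = mcol b e' ->
  e.1.1 < e'.1.1 -> e'.1.2 < e.1.2 -> mrow a e < mrow a e'.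
Proof.
move=> d d' cc ss tt.
rewrite ltn_neqAle (reg_col rg) //; last by lia.
rewrite andbT; apply/eqP => rr.
by move: tt; rewrite (reg_plain rg d d') // ltnn.
Qed.

(** Suppose that e' is not to the right of e. The row of e' contains a mark f with
    the t of e, lying to the left of e' and with s_f <= s. Then the block of
    marks at (s, t) extends far enough to the left to contain a mark g in the column
    of e', and [col_strict] puts e' above g, hence above e. *)
Lemma later_mark_right e e' : is_mark c e -> is_mark c e' -> mrow a e <= mrow a e' ->
  e.1.2 < e'.1.2 -> mcol b e < mcol b e'.
Proof.
move=> d d' rr tt; rewrite ltnNge; apply/negP => cc.
have cx : c (mrow a e') e.1.2 = 1%R by apply: (c_down st (mark_row_in d')) => //; apply: ltnW.
have [f [df tf rf sf]] := mark_exists_row d rr (leqnn _) cx.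
have [sf' cf] : e'.1.1 < f.1.1 /\ mcol b f < mcol b e' by apply: row_strict; rewrite ?tf.
have le1 : b e.1.1 e.1.2 <= mcol b f.
  by apply: leq_trans (b_antitone st _ sf) _; rewrite -tf leq_addr.
(* the mark of the block of e that lies in the column of e' *)
pose g : mark := (e.1, e.2 - (mcol b e - mcol b e')).
have dg : is_mark c g by move: d; rewrite /is_mark /=; lia.
have cg : mcol b g = mcol b e' by move: cc le1 cf; rewrite /mcol /= /mcol; lia.
have rg' : mrow a g <= mrow a e by rewrite /mrow /=; lia.
have : mrow a e' < mrow a g.
  apply: col_strict => //=; apply: leq_trans sf' sf.
lia.
Qed.

(** Induction on the column, and then on s. In the column of e, the cells not removed
    by marks with a larger or equal s are at least s in number; in its row, the
    cells not removed by marks with a larger or equal t are at least t in number,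
    and [row_strict] shows that the marks with a smaller t are in earlier
    columns. *)
Lemma antidiagonal_capturing : capturing c a b.
Proof.
move=> i j U [sc sr] nrem small.
suff cap y s e : is_mark c e -> mcol b e = y -> e.1.1 = s -> U (mrow a e) (mcol b e).
  move=> x y cxy; case: (pselect (removed c a b x y)) => [[e [d <- <-]]|]; last exact: nrem.
  exact: cap d erefl erefl.
elim/ltn_ind: y s e => y IHy; elim/ltn_ind => s IHs e d ey es.
have [si|si] := leqP e.1.1 i; last first.
  have [S [uS zS inS]] := unblocked_column st d.
  apply: (sc _ (take i.+1 S)); rewrite ?take_uniq ?size_takel ?zS //; last exact: mark_in_diagram.
  move=> x /mem_take /inS[cx lt]; split=> //.
  case: (pselect (removed c a b x (mcol b e))) => [[e' [d' r' c']]|]; last exact: nrem.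
  rewrite -r' -c'; apply: (IHs e'.1.1) => //; last by rewrite c'.
  by rewrite -es; apply: lt.
have [tj|tj] := leqP e.1.2 j; first exact: small.
have [S [uS zS inS]] := unblocked_column st' (d : is_mark (transp c) (swap_mark e)).
apply: (sr _ (take j.+1 S)); rewrite ?take_uniq ?size_takel ?zS //; last exact: mark_in_diagram.
move=> x /mem_take /inS[cx lt]; split=> //.
case: (pselect (removed c a b (mrow a e) x)) => [[e' [d' r' c']]|]; last exact: nrem.
rewrite -r' -c'; apply: (IHy (mcol b e')) => //; rewrite -ey.
have /= t' := lt (swap_mark e') d' c' r'.
by have [] := row_strict d' d r' t'.
Qed.

(** Here q is the first column that either leaves the diagram in row i or contains a
    mark with s <= i and t <= j. For p, the first such row, marks with s > i must be
    taken into account too: they may lie above the marks with s <= i of their own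
    column, and Q must contain both. Marks with t > j never lie to the left of
    column q, by [later_mark_right]. *)
Lemma antidiagonal_balanced : balanced c a b.
Proof.
move=> i j cij.
pose Q y := `[< (c i y <= 0)%R \/ exists e, [/\ is_mark c e, mcol b e = y, e.1.1 <= i & e.1.2 <= j] >].
have exQ : exists y, Q y by exists j; apply/asboolP; left.
case: (ex_minnP exQ) => q /asboolP Qq minq {exQ}.
pose P x := `[< (c x j <= 0)%R \/ exists e, [/\ is_mark c e, mrow a e = x, e.1.2 <= j & q <= mcol b e] >].
have exP : exists x, P x by exists i; apply/asboolP; left.
case: (ex_minnP exP) => p /asboolP Pp minp {exP}.
have Nq e : is_mark c e -> e.1.1 <= i -> e.1.2 <= j -> q <= mcol b e.
  by move=> d si tj; apply: minq; apply/asboolP; right; exists e.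
have Np e : is_mark c e -> e.1.2 <= j -> q <= mcol b e -> p <= mrow a e.
  by move=> d tj qe; apply: minp; apply/asboolP; right; exists e.
(* a diagram cell below row i, right of column q, forces q to come from a mark *)
have below x y : c x y = 1%R -> q <= y -> i < x ->
    exists e, [/\ is_mark c e, mcol b e <= y, e.1.1 <= i & e.1.2 <= j].
  move=> cxy qy ix; case: Qq => [ciq|[e [d ee si tj]]]; last by exists e; rewrite ee.
  by have := stair_mono st ciq (ltnW ix) qy; rewrite cxy.
exists p, q; split.
- move=> x y xi yj; rewrite negb_and -!ltnNge => /orP[xp|yq].
    case: (c_one_or_le0 st x j) => [cx|cx]; first exact: (c_down st cx).
    have := minp x; rewrite leqNgt xp => /(_ _)/negP; case; last by [].
    by apply/asboolP; left.
  case: (c_one_or_le0 st i y) => [cx|cx]; first exact: (c_down st cx).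
  have := minq y; rewrite leqNgt yq => /(_ _)/negP; case; last by [].
  by apply/asboolP; left.
- by move=> e d si tj; have qe := Nq e d si tj; split=> //; apply: Np.
- move=> x y cxy px qy ix; have [e [d ey si tj]] := below x y cxy qy ix.
  have [e' [d' s' c' t']] := mark_exists st d ey (leq_trans si (ltnW ix)) cxy.
  have tj' := leq_trans t' tj.
  by exists e'; split=> //; apply: Np; rewrite ?c'.
- move=> x y cxy px qy jy.
  case: Pp => [cpj|[e [d ee tj qe]]].
    by have := stair_mono st cpj px (ltnW jy); rewrite cxy.
  have [|e' [d' t' r' s']] := mark_exists_row d _ (leq_trans tj (ltnW jy)) cxy.
    by rewrite ee.
  have qe' : q <= mcol b e'.
    apply: ltnW; apply: leq_ltn_trans qe _; apply: later_mark_right => //.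
      by rewrite ee r'.
    by rewrite t'; apply: leq_ltn_trans jy.
  exists e'; split=> //; rewrite leqNgt; apply/negP => si.
  have [f [df cf sf tf]] := below _ _ (mark_col_in st d') qe' si.
  have := mark_anti st df d' cf (leq_trans sf (ltnW si)); rewrite t'; lia.
Qed.

End Antidiagonal.

Local Open Scope ring_scope.

(** * Evaluation vectors in general position *)

Section GeneralPosition.
Variable k : fieldType.

Definition form i (F : nat -> k) (v : 'rV[k]_2) : k :=
  \sum_(l < i.+1) F l * (v 0 0 ^+ l * v 0 1 ^+ (i - l)).

Definition powers i (v : 'rV[k]_2) : 'rV[k]_i.+1 :=
  \row_(l < i.+1) (v 0 0 ^+ l * v 0 1 ^+ (i - l)).

Lemma powers_mul i F v : powers i v *m (\col_l F (val l)) = (form i F v)%:M.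
Proof.
apply/matrixP => p q; rewrite !ord1 !mxE eqxx mulr1n; apply: eq_bigr => l _.
by rewrite !mxE mulrC.
Qed.

Lemma form_mul i F p q : exists G, forall v,
  form i.+1 G v = form i F v * (p * v 0 0 + q * v 0 1).
Proof.
exists (fun l => (if l is l'.+1 then p * F l' else 0) +
                 (if (l <= i)%N then q * F l else 0)) => v.
rewrite /form mulrDr !mulr_suml.
under eq_bigr do rewrite mulrDl.
rewrite big_split /=; congr (_ + _).
  rewrite big_ord_recl /= mul0r add0r; apply: eq_bigr => l _.
  by rewrite /bump add1n /= subSS exprS; ring.
rewrite big_ord_recr /= ltnn mul0r addr0; apply: eq_bigr => l _.
have li : (l <= i)%N by rewrite -ltnS.
by rewrite li subSn // exprS; ring.
Qed.

Definition independent (u v : 'rV[k]_2) := u 0 0 * v 0 1 - u 0 1 * v 0 0 != 0.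

(** Multiply the linear forms vanishing at the points of us, and pad the degree with
    linear forms that do not vanish at u0. *)
Lemma separating_form (u0 : 'rV[k]_2) (us : seq 'rV[k]_2) i :
  u0 != 0 -> (forall u, u \in us -> independent u u0) -> (size us <= i)%N ->
  exists F, form i F u0 != 0 /\ forall u, u \in us -> form i F u = 0.
Proof.
move=> u0n; elim: i us => [|i IH] us ind.
  rewrite leqn0 size_eq0 => /eqP->; exists (fun=> 1); split=> //.
  by rewrite /form big_ord1 /= !expr0 !mulr1 oner_neq0.
case: us ind => [|u us] ind sz.
  have [F [F0 _]] := IH [::] ltac:(by []) isT.
  have [p [q pq]] : exists p q, p * u0 0 0 + q * u0 0 1 != 0.
    have [z|z] := eqVneq (u0 0 0) 0; last by exists 1, 0; rewrite mul1r mul0r addr0.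
    exists 0, 1; rewrite mul1r mul0r add0r; apply: contraNneq u0n => z'.
    by apply/eqP/rowP => l; rewrite !mxE; case: l => -[|[|//]] ?;
      [rewrite -[RHS]z | rewrite -[RHS]z']; congr (u0 _ _); apply: val_inj.
  by have [G GE] := form_mul i F p q; exists G; split=> //; rewrite GE mulf_neq0.
have [|//|F [F0 Fus]] := IH us.
  by move=> w wus; apply: ind; rewrite inE wus orbT.
have [G GE] := form_mul i F (- u 0 1) (u 0 0).
exists G; split.
  rewrite GE mulf_neq0 //; have := ind u (mem_head _ _).
  by apply: contraNneq => <-; rewrite mulNr addrC.
move=> w; rewrite inE => /orP[/eqP->|/Fus wF]; rewrite GE ?wF ?mul0r //.
by rewrite mulNr [u 0 1 * _]mulrC addNr mulr0.
Qed.

(** Linear independence of any at most m+1 of the vectors phi_x, expressed by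
    separating functionals: this is the form in which it is obtained, and it passes
    to tensor products by multiplying functionals. *)
Definition general_position m A (phi : nat -> 'rV[k]_m.+1) :=
  forall (S : seq nat) x0, (forall x, x \in S -> (x < A)%N) -> (x0 < A)%N ->
    x0 \notin S -> (size S <= m)%N ->
    exists F : 'cV[k]_m.+1, phi x0 *m F != 0 /\ forall x, x \in S -> phi x *m F = 0.

Lemma powers_general_position m A (u : nat -> 'rV[k]_2) :
  (forall x, (x < A)%N -> u x != 0) ->
  (forall x y, (x < A)%N -> (y < A)%N -> x <> y -> independent (u x) (u y)) ->
  general_position A (fun x => powers m (u x)).
Proof.
move=> un uind S x0 SA x0A x0S szS.
have [|||F [F0 FS]] := @separating_form (u x0) (map u S) m; rewrite ?size_map //.
- exact: un.
- move=> _ /mapP[x xS ->]; apply: uind => //; first exact: SA.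
  by move=> xx; move: x0S; rewrite -xx xS.
exists (\col_l F (val l)); split.
  rewrite powers_mul; apply: contraNneq F0 => /matrixP/(_ 0 0).
  by rewrite !mxE eqxx mulr1n => ->.
by move=> x xS; rewrite powers_mul FS ?map_f // raddf0.
Qed.

Lemma free_dual (V : vectType k) (T : eqType) (f : T -> V) (s : seq T) :
  uniq s ->
  (forall x, x \in s -> exists g : V -> k^o,
     [/\ linear g, g (f x) != 0 & forall y, y \in s -> y != x -> g (f y) = 0]) ->
  free (map f s).
Proof.
elim: s => [|x s IH] /=; first by rewrite nil_free.
move=> /andP[xs us] dual; rewrite free_cons IH //; last first.
  move=> y ys; have [|g [gl gy gs]] := dual y; first by rewrite inE ys orbT.
  by exists g; split=> // z zs; apply: gs; rewrite inE zs orbT.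
rewrite andbT; have [|g [gl gx gs]] := dual x; first exact: mem_head.
pose h : {linear V -> k^o} := HB.pack g (GRing.isLinear.Build _ _ _ _ g gl).
apply/negP => xspan; move/negP: gx; apply.
have sub : (<<map f s>> <= lker (linfun h))%VS.
  apply/span_subvP => _ /mapP[y ys ->]; rewrite memv_ker lfunE /=.
  by rewrite gs // ?inE ?ys ?orbT //; apply: contraNneq xs => <-.
by have := subvP sub _ xspan; rewrite memv_ker lfunE.
Qed.

Lemma general_position_span l C (chi : nat -> 'rV[k]_l.+1) S :
  general_position C chi -> uniq S -> size S = l.+1 ->
  (forall x, x \in S -> (x < C)%N) -> <<map chi S>>%VS = fullv.
Proof.
move=> gchi uS zS SC; apply/eqP; rewrite eqEdim subvf /= dimvf.
have fS : free (map chi S).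
  apply: free_dual => // x xS.
  have [||||F [Fx F0]] := gchi (rem x S) x.
  - by move=> y /mem_rem; apply: SC.
  - exact: SC.
  - by rewrite mem_rem_uniq // inE eqxx.
  - by rewrite size_rem // zS.
  exists (fun v => (v *m F) 0 0); split.
  - by move=> a v w; rewrite mulmxDl -scalemxAl !mxE.
  - by apply: contraNneq Fx => v0; apply/eqP/matrixP => p q; rewrite !ord1 v0 mxE.
  - by move=> y yS yx; rewrite F0 ?mxE // mem_rem_uniq // inE yx.
by move: fS => /eqP->; rewrite size_map zS /dim /= mul1n.
Qed.

Section Tensor.
Variables (m n A B : nat) (phi : nat -> 'rV[k]_m.+1) (psi : nat -> 'rV[k]_n.+1).
Hypotheses (gphi : general_position A phi) (gpsi : general_position B psi).

Definition tensor (p : nat * nat) : 'M[k]_(m.+1, n.+1) := (phi p.1)^T *m psi p.2.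

(** The vectors phi_x' with x' in S span the whole space, and tensoring with psi_y is
    linear. *)
Lemma tensor_column S x y : uniq S -> size S = m.+1 ->
  (forall x', x' \in S -> (x' < A)%N) ->
  tensor (x, y) \in <<[seq tensor (x', y) | x' <- S]>>%VS.
Proof.
move=> uS zS SA; pose h (v : 'rV[k]_m.+1) : 'M[k]_(m.+1, n.+1) := v^T *m psi y.
have hl : linear h by move=> a v w; rewrite /h linearP /= mulmxDl scalemxAl.
pose h' : {linear _ -> 'M[k]_(m.+1, n.+1)} := HB.pack h (GRing.isLinear.Build _ _ _ _ h hl).
have -> : [seq tensor (x', y) | x' <- S] = map (linfun h') (map phi S).
  by rewrite -map_comp; apply: eq_map => x'; rewrite /= (lfunE h').
rewrite -limg_span (general_position_span gphi) //.
have -> : tensor (x, y) = linfun h' (phi x) by rewrite (lfunE h').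
exact: memv_img (memvf _).
Qed.

Lemma tensor_row S x y : uniq S -> size S = n.+1 ->
  (forall y', y' \in S -> (y' < B)%N) ->
  tensor (x, y) \in <<[seq tensor (x, y') | y' <- S]>>%VS.
Proof.
move=> uS zS SB; pose h (v : 'rV[k]_n.+1) : 'M[k]_(m.+1, n.+1) := (phi x)^T *m v.
have hl : linear h by move=> a v w; rewrite /h linearP.
pose h' : {linear _ -> 'M[k]_(m.+1, n.+1)} := HB.pack h (GRing.isLinear.Build _ _ _ _ h hl).
have -> : [seq tensor (x, y') | y' <- S] = map (linfun h') (map psi S).
  by rewrite -map_comp; apply: eq_map => y'; rewrite /= (lfunE h').
rewrite -limg_span (general_position_span gpsi) //.
have -> : tensor (x, y) = linfun h' (psi y) by rewrite (lfunE h').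
exact: memv_img (memvf _).
Qed.

(** In a rectangle with m+1 rows and n+1 columns, a cell is separated from the others
    by the tensor product of a functional separating its row and one separating its
    column. *)
Lemma tensor_free (s : seq (nat * nat)) : uniq s ->
  (forall p, p \in s -> [/\ p.1 < A, p.1 <= m, p.2 < B & p.2 <= n]%N) ->
  free (map tensor s).
Proof.
move=> us in_rect; apply: free_dual => // -[x y] xys.
have dual l C (chi : nat -> 'rV[k]_l.+1) z : general_position C chi ->
    (z < C)%N -> (z <= l)%N -> exists F : 'cV[k]_l.+1, chi z *m F != 0 /\ forall z', (z' < C)%N -> (z' <= l)%N -> z' != z -> chi z' *m F = 0.
  move=> gchi zC zl.
  have [s0 [us0 ms0 zs0]] : exists s0, [/\ uniq s0,
      forall w, (w \in s0) = (w <= l)%N & size s0 = l.+1].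
    by exists (iota 0 l.+1); split; rewrite ?iota_uniq ?size_iota // => w;
      rewrite mem_iota.
  have [||||F [F0 FS]] := gchi [seq w <- s0 | (w < C)%N && (w != z)] z.
  - by move=> w; rewrite mem_filter => /andP[/andP[]].
  - exact: zC.
  - by rewrite mem_filter eqxx andbF.
  - have -> : l = size (rem z s0) by rewrite size_rem ?ms0 // zs0.
    apply: uniq_leq_size; first by rewrite filter_uniq.
    move=> w; rewrite mem_filter mem_rem_uniq // inE.
    by move=> /andP[/andP[_ ->] ->].
  exists F; split=> // w wC wl wz; apply: FS.
  by rewrite mem_filter wC wz ms0.
have [/= xA xm yB yn] := in_rect _ xys.
have [F [Fx FS]] := dual _ _ _ _ gphi xA xm.
have [G [Gx GS]] := dual _ _ _ _ gpsi yB yn.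
have E p : F^T *m tensor p *m G = (phi p.1 *m F)^T *m (psi p.2 *m G).
  by rewrite trmx_mul /tensor !mulmxA.
exists (fun v => (F^T *m v *m G) 0 0); split.
- by move=> a v w; rewrite linearP /= mulmxDl -scalemxAl !mxE.
- rewrite E mxE big_ord1 mxE mulf_neq0 //.
    by apply: contraNneq Fx => v0; apply/eqP/matrixP => p q; rewrite !ord1 v0 mxE.
  by apply: contraNneq Gx => v0; apply/eqP/matrixP => p q; rewrite !ord1 v0 mxE.
move=> [x' y'] /in_rect[/= x'A x'm y'B y'n] ne; rewrite E mxE big_ord1 mxE /=.
have [xx|xx] := eqVneq x' x; last by rewrite FS // mxE mul0r.
rewrite GS ?mxE ?mulr0 //; apply: contraNneq ne => ->; by rewrite xx.
Qed.

End Tensor.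
End GeneralPosition.

(** * The dimension spanned by the remaining cells *)

Definition grid m n : seq (nat * nat) := [seq (x, y) | x <- iota 0 m, y <- iota 0 n].

Lemma mem_grid m n p : (p \in grid m n) = (p.1 < m)%N && (p.2 < n)%N.
Proof.
case: p => x y; apply/allpairsP/andP => [[[x' y'] /= [+ + [-> ->]]]|[xm yn]].
  by rewrite !mem_iota.
by exists (x, y); rewrite !mem_iota.
Qed.

Lemma grid_uniq m n : uniq (grid m n).
Proof. by rewrite allpairs_uniq ?iota_uniq // => -[? ?] [? ?] _ _ /=. Qed.

(** The number of marks at a matrix entry z. *)
Definition defect (z : int) : nat := if z is Negz n then n.+1 else 0.

Lemma is_markE c e : is_mark c e <-> (e.2 < defect (c e.1.1 e.1.2))%N.
Proof. by rewrite /is_mark /defect; case: (c _ _) => n; lia. Qed.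

Lemma le1_split (z : int) : z <= 1 -> z = Posz (z == 1) - Posz (defect z).
Proof.
by case: z => [[|[|n]]|n] le1 //=; lia.
Qed.

Section Dimension.
Variables (c : nat -> nat -> int) (a b : nat -> nat -> nat).
Hypotheses (st : staircase c a b) (rg : regular c a b).
Hypotheses (cap : capturing c a b) (bal : balanced c a b).
Variables (A B i j : nat).
Hypothesis cAB : forall x y, c x y = 1 -> (x < A)%N && (y < B)%N.

Definition mark_cell e := (mrow a e, mcol b e).

Definition diagram := [seq p <- grid A B | c p.1 p.2 == 1].
Definition is_removed (p : nat * nat) : bool := `[< removed c a b p.1 p.2 >].
Definition remaining := [seq p <- diagram | ~~ is_removed p].
Definition in_rect (p : nat * nat) := (p.1 <= i)%N && (p.2 <= j)%N.
Definition small_marks : seq mark :=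
  [seq (p, r) | p <- grid i.+1 j.+1, r <- iota 0 (defect (c p.1 p.2))].

Lemma mem_diagram p : (p \in diagram) = (c p.1 p.2 == 1).
Proof.
rewrite mem_filter mem_grid; case: eqP => //= /cAB/andP[-> ->] //.
Qed.

Lemma diagram_uniq : uniq diagram.
Proof. by rewrite filter_uniq ?grid_uniq. Qed.

Lemma mem_small e : reflect [/\ is_mark c e, (e.1.1 <= i)%N & (e.1.2 <= j)%N] (e \in small_marks).
Proof.
apply: (iffP allpairsPdep).
  move=> [p [r [pg rd ->]]] /=; move: pg rd; rewrite mem_grid mem_iota /=.
  by move=> /andP[pi pj] rd; split=> //; apply/is_markE.
case: e => p r [/is_markE d si tj]; exists p, r; split=> //.
  by rewrite mem_grid !ltnS si tj.
by rewrite mem_iota.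
Qed.

Lemma small_uniq : uniq small_marks.
Proof.
apply: allpairs_uniq_dep; rewrite ?grid_uniq //.
  by move=> p _; apply: iota_uniq.
by move=> [p r] [p' r'] _ _ /= [-> ->].
Qed.

(** An entry is 1 on the diagram, and elsewhere minus its number of marks. *)
Lemma sum_delta : \sum_(p <- grid i.+1 j.+1) c p.1 p.2 =
  Posz (count in_rect diagram) - Posz (size small_marks).
Proof.
rewrite (eq_bigr (fun p => Posz (c p.1 p.2 == 1) - Posz (defect (c p.1 p.2)))).
  rewrite sumrB; congr (_ - _).
    rewrite -(big_morph Posz PoszD (erefl 0)); congr Posz.
    rewrite -sum1_count -[RHS]big_filter.
    rewrite -big_mkcond /= -[LHS]big_filter; apply: perm_big; apply: uniq_perm.
    - by rewrite filter_uniq ?grid_uniq.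
    - by rewrite filter_uniq ?diagram_uniq.
    by move=> p; rewrite mem_filter [in RHS]mem_filter mem_diagram mem_grid /in_rect !ltnS andbC.
  rewrite -(big_morph Posz PoszD (erefl 0)); congr Posz.
  rewrite size_allpairs_dep sumnE big_map; apply: eq_bigr => p _.
  by rewrite size_iota.
by move=> p _; apply: le1_split; apply: (stair_le1 st).
Qed.

Lemma leq_count_add (T : Type) (P1 P2 P3 P4 P5 : pred T) (s : seq T) :
  (forall x, P1 x + P2 x <= P3 x + P4 x + P5 x)%N ->
  (count P1 s + count P2 s <= count P3 s + count P4 s + count P5 s)%N.
Proof. by move=> le; elim: s => //= x s IH; have := le x; lia. Qed.

Definition in_corner p q (z : nat * nat) := (p <= z.1)%N && (q <= z.2)%N.

(** The marks with s <= i and t <= j, those attached to cells below row i (for which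
    s > i, t <= j) and those attached to cells right of column j (for which
    s <= i, t > j) are pairwise distinct, and plainness makes their cells distinct. *)
Lemma count_removed_corner p q :
  (forall e, is_mark c e -> e.1.1 <= i -> e.1.2 <= j -> p <= mrow a e /\ q <= mcol b e)%N ->
  (forall x y, c x y = 1 -> p <= x -> q <= y -> i < x ->
        exists e, [/\ is_mark c e, e.1.1 = x, mcol b e = y, e.1.2 <= j & p <= mrow a e])%N ->
  (forall x y, c x y = 1 -> p <= x -> q <= y -> j < y ->
        exists e, [/\ is_mark c e, e.1.2 = y, mrow a e = x, e.1.1 <= i & q <= mcol b e])%N ->
  (size small_marks + count (fun z => in_corner p q z && (i < z.1)) diagram +
     count (fun z => in_corner p q z && (j < z.2)) diagram
   <= count (fun z => in_corner p q z && is_removed z) diagram)%N.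
Proof.
move=> N S T.
pose XS := [seq z <- diagram | in_corner p q z && (i < z.1)%N].
pose XT := [seq z <- diagram | in_corner p q z && (j < z.2)%N].
have /choice[f fP] z : exists e, z \in XS -> [/\ is_mark c e, e.1.1 = z.1,
    mcol b e = z.2, (e.1.2 <= j)%N & (p <= mrow a e)%N].
  case: (boolP (z \in XS)) => [|_]; last by exists (0, 0, 0)%N.
  rewrite mem_filter mem_diagram => /andP[/andP[/andP[pz qz] iz] /eqP cz].
  by have [e ?] := S _ _ cz pz qz iz; exists e.
have /choice[g gP] z : exists e, z \in XT -> [/\ is_mark c e, e.1.2 = z.2,
    mrow a e = z.1, (e.1.1 <= i)%N & (q <= mcol b e)%N].
  case: (boolP (z \in XT)) => [|_]; last by exists (0, 0, 0)%N.
  rewrite mem_filter mem_diagram => /andP[/andP[/andP[pz qz] iz] /eqP cz].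
  by have [e ?] := T _ _ cz pz qz iz; exists e.
pose L := small_marks ++ map f XS ++ map g XT.
have inXS z : z \in XS -> [/\ (p <= z.1)%N, (q <= z.2)%N & (i < z.1)%N].
  by rewrite mem_filter => /andP[/andP[/andP[]]].
have inXT z : z \in XT -> [/\ (p <= z.1)%N, (q <= z.2)%N & (j < z.2)%N].
  by rewrite mem_filter => /andP[/andP[/andP[]]].
have LP e : e \in L -> [/\ is_mark c e, (p <= mrow a e)%N & (q <= mcol b e)%N].
  rewrite mem_cat [X in _ || X]mem_cat => /or3P[/mem_small[d si tj]|/mapP[z zS ->]|/mapP[z zT ->]].
  - by have [] := N e d si tj.
  - by have [d _ -> _ ->] := fP z zS; have [_ -> _] := inXS z zS.
  - by have [d _ -> _ ->] := gP z zT; have [-> _ _] := inXT z zT.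
have uXS : uniq XS by rewrite filter_uniq ?diagram_uniq.
have uXT : uniq XT by rewrite filter_uniq ?diagram_uniq.
have uL : uniq L.
  rewrite cat_uniq small_uniq has_cat negb_or [X in [&& _, _ & X]]cat_uniq.
  rewrite !map_inj_in_uniq ?uXS ?uXT /=; last 2 first.
  - move=> z z' /gP[_ z2 z1 _ _] /gP[_ z2' z1' _ _] gg.
    by rewrite [z]surjective_pairing [z']surjective_pairing -z1 -z1' -z2 -z2' gg.
  - move=> z z' /fP[_ z1 z2 _ _] /fP[_ z1' z2' _ _] ff.
    by rewrite [z]surjective_pairing [z']surjective_pairing -z1 -z1' -z2 -z2' ff.
  rewrite andbT -andbA; apply/and3P; split.
  - apply/hasPn => _ /mapP[z zS ->]; apply/mem_small => -[_ + _].
    by have [_ -> _ _ _] := fP z zS; have [_ _] := inXS z zS; lia.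
  - apply/hasPn => _ /mapP[z zT ->]; apply/mem_small => -[_ _].
    by have [_ -> _ _ _] := gP z zT; have [_ _] := inXT z zT; lia.
  - apply/hasPn => _ /mapP[z zT ->]; apply/mapP => -[z' zS gf].
    have [_ z2 _ _ _] := gP z zT; have [_ _ _ + _] := fP z' zS.
    by have [_ _] := inXT z zT; rewrite -gf z2; lia.
have -> : (size small_marks + count (fun z => in_corner p q z && (i < z.1)) diagram +
    count (fun z => in_corner p q z && (j < z.2)) diagram = size (map mark_cell L))%N.
  by rewrite size_map (size_cat small_marks) (size_cat (map f XS)) (size_map f) (size_map g) !size_filter addnA.
rewrite -size_filter; apply: uniq_leq_size.
  rewrite map_inj_in_uniq // => e e' /LP[d _ _] /LP[d' _ _] [].
  exact: (reg_plain rg).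
move=> _ /mapP[e /LP[d pe qe] ->].
rewrite mem_filter mem_diagram /in_corner /= pe qe (mark_in_diagram st d) /= andbT.
by apply/asboolP; exists e.
Qed.

Variable k : fieldType.
Variables (phi : nat -> 'rV[k]_i.+1) (psi : nat -> 'rV[k]_j.+1).
Hypotheses (gphi : general_position A phi) (gpsi : general_position B psi).

Local Notation tns := (tensor phi psi).

Lemma tensor_R_free : free (map tns [seq z <- diagram | in_rect z]).
Proof.
apply: (tensor_free gphi gpsi); first by rewrite filter_uniq ?diagram_uniq.
move=> z; rewrite mem_filter mem_diagram => /andP[/andP[zi zj] /eqP cz].
by have /andP[-> ->] := cAB cz; rewrite zi zj.
Qed.

Lemma dim_lower :
  (count in_rect diagram <= \dim <<map tns remaining>> + size small_marks)%N.
Proof.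
have := tensor_R_free; move/eqP; rewrite size_map size_filter => <-.
pose W := (<<map tns remaining>> + <<map tns (map mark_cell small_marks)>>)%VS.
have leW : (\dim W <= \dim <<map tns remaining>> + size small_marks)%N.
  apply: leq_trans (dimv_add_leqif _ _).1 _; rewrite leq_add2l.
  by apply: leq_trans (dim_span _) _; rewrite !size_map.
apply: leq_trans leW; apply/dimvS/span_subvP => _ /mapP[[x y] + ->].
rewrite mem_filter mem_diagram => /andP[_ /eqP /= cxy].
apply: (cap (i := i) (j := j) (U := fun x y => tns (x, y) \in W)) cxy.
- split=> [y' S uS zS SU x' cx'|x' S uS zS SU y' cx'].
    have := tensor_column psi gphi x' y' uS zS.
    move=> /(_ (fun z zS => proj1 (andP (cAB (proj1 (SU z zS))))))/(subvP _); apply.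
    by apply/span_subvP => _ /mapP[z /SU[_ zW] ->].
  have := tensor_row phi gpsi x' y' uS zS.
  move=> /(_ (fun z zS => proj2 (andP (cAB (proj1 (SU z zS))))))/(subvP _); apply.
  by apply/span_subvP => _ /mapP[z /SU[_ zW] ->].
- move=> x' y' cx' nr; apply: (subvP (addvSl _ _)); apply: memv_span.
  apply: map_f; rewrite mem_filter mem_diagram /= cx' eqxx andbT.
  by apply/asboolPn.
- move=> e d si tj; apply: (subvP (addvSr _ _)); apply: memv_span.
  by apply: (map_f tns (x := mark_cell e)); apply: map_f; apply/mem_small.
Qed.

Lemma dim_upper :
  (\dim <<map tns remaining>> + size small_marks <= count in_rect diagram)%N.
Proof.
have [c1|c0] := c_one_or_le0 st i j.
  (* the rectangle is contained in the diagram: all forms of bidegree (i, j) *)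
  have -> : size small_marks = 0%N.
    apply/eqP; rewrite size_eq0; apply/eqP.
    case E: small_marks => [//|e s]; have : e \in small_marks by rewrite E mem_head.
    move=> /mem_small[/mark_neg ce si tj].
    by move: ce; rewrite (c_down st c1 si tj).
  rewrite addn0; apply: leq_trans (dimvS (subvf _)) _; rewrite dimvf /dim /=.
  have -> : (i.+1 * j.+1 = size (grid i.+1 j.+1))%N by rewrite size_allpairs !size_iota.
  rewrite -size_filter; apply: (uniq_leq_size (grid_uniq i.+1 j.+1)) => z.
  rewrite mem_grid mem_filter mem_diagram !ltnS /in_rect => /andP[zi zj].
  by rewrite zi zj (c_down st c1 zi zj).
have [p [q [RQ N S T]]] := bal c0.
have rc := count_removed_corner N S T.
pose RnQ := [seq z <- diagram | in_rect z && ~~ in_corner p q z].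
pose ZQ := [seq z <- remaining | in_corner p q z].
have le1 : (\dim <<map tns remaining>> <= size RnQ + size ZQ)%N.
  have sub : (<<map tns remaining>> <= <<map tns RnQ>> + <<map tns ZQ>>)%VS.
    apply/span_subvP => _ /mapP[[x y] xyZ ->].
    have [xyQ|xynQ] := boolP (in_corner p q (x, y)).
      apply: (subvP (addvSr _ _)); apply/memv_span/map_f.
      by rewrite mem_filter xyQ xyZ.
    apply: (subvP (addvSl _ _)).
    have /andP[/= xA yB] : (x < A)%N && (y < B)%N.
      by apply: cAB; move: xyZ; rewrite mem_filter mem_diagram => /andP[_ /eqP].
    have cxy : c x y = 1 by move: xyZ; rewrite mem_filter mem_diagram => /andP[_ /eqP].
    have [xyR|xynR] := boolP (in_rect (x, y)).
      by apply/memv_span/map_f; rewrite mem_filter mem_diagram xyR xynQ /= cxy.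
    have Rc x' y' : (x' <= i)%N -> (y' <= j)%N -> ~~ in_corner p q (x', y') ->
        tns (x', y') \in <<map tns RnQ>>%VS.
      move=> xi yj nQ; apply/memv_span/map_f.
      by rewrite mem_filter mem_diagram /in_rect /= xi yj nQ (RQ x' y').
    move: xynQ; rewrite /in_corner /= negb_and -!ltnNge => /orP[xp|yq].
      (* i < x < p would put the cell (i, j) in the diagram *)
      have [xi|ix] := leqP x i; last first.
        have := RQ i j (leqnn _) (leqnn _); rewrite negb_and -!ltnNge.
        by rewrite (ltn_trans ix xp) => /(_ isT) c1; move: c0; rewrite c1.
      have jy : (j < y)%N by move: xynR; rewrite /in_rect /= xi /= -ltnNge.
      have := tensor_row phi gpsi x y (iota_uniq 0 j.+1) (size_iota _ _).
      have lt z : z \in iota 0 j.+1 -> (z < B)%N.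
        by rewrite mem_iota add0n ltnS /= => zj; apply: leq_ltn_trans zj (ltn_trans jy yB).
      move=> /(_ lt)/(subvP _); apply; apply/span_subvP => _ /mapP[z + ->].
      rewrite mem_iota add0n ltnS /= => zj; apply: Rc => //.
      by rewrite /in_corner /= negb_and -ltnNge xp.
    have [yj|jy] := leqP y j; last first.
      have := RQ i j (leqnn _) (leqnn _); rewrite negb_and -!ltnNge.
      by rewrite (ltn_trans jy yq) orbT => /(_ isT) c1; move: c0; rewrite c1.
    have ix : (i < x)%N by move: xynR; rewrite /in_rect /= yj andbT -ltnNge.
    have := tensor_column psi gphi x y (iota_uniq 0 i.+1) (size_iota _ _).
    have lt z : z \in iota 0 i.+1 -> (z < A)%N.
      by rewrite mem_iota add0n ltnS /= => zj; apply: leq_ltn_trans zj (ltn_trans ix xA).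
    move=> /(_ lt)/(subvP _); apply; apply/span_subvP => _ /mapP[z + ->].
    rewrite mem_iota add0n ltnS /= => zj; apply: Rc => //.
    by rewrite /in_corner /= negb_and -!ltnNge yq orbT.
  apply: leq_trans (dimvS sub) _; apply: leq_trans (dimv_add_leqif _ _).1 _.
  by apply: leq_add; apply: leq_trans (dim_span _) _; rewrite size_map.
have zq : (size ZQ + count (fun z => in_corner p q z && is_removed z) diagram = count (in_corner p q) diagram)%N.
  rewrite size_filter /remaining count_filter -count_predUI.
  rewrite addnC [X in (X + _)%N](eq_count (a2 := pred0)); last first.
    by move=> z /=; case: (in_corner p q z); case: (is_removed z).
  rewrite count_pred0 add0n; apply: eq_count => z /=.
  by case: (in_corner p q z); case: (is_removed z).
have pw := @leq_count_add _ (fun z => in_rect z && ~~ in_corner p q z) (in_corner p q)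
  in_rect (fun z => in_corner p q z && (i < z.1)%N) (fun z => in_corner p q z && (j < z.2)%N) diagram.
have : (size RnQ + count (in_corner p q) diagram <= count in_rect diagram +
    count (fun z => in_corner p q z && (i < z.1)) diagram +
    count (fun z => in_corner p q z && (j < z.2)) diagram)%N.
  rewrite size_filter; apply: pw => z; rewrite /in_rect !(ltnNge _ z.1, ltnNge _ z.2).
  by case: (z.1 <= i)%N; case: (z.2 <= j)%N; case: (in_corner p q z).
lia.
Qed.

Lemma dim_remaining :
  Posz (\dim <<map tns remaining>>) = \sum_(z <- grid i.+1 j.+1) c z.1 z.2.
Proof. by rewrite sum_delta; have := dim_lower; have := dim_upper; lia. Qed.

End Dimension.

Local Open Scope classical_set_scope.

(** * Bihomogeneous forms and the Hilbert function *)

Section Forms.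
Variables (k : closedFieldType) (m n : nat).

(** The exponents of the monomial x_0^a x_1^(m-a) y_0^b y_1^(n-b). *)
Definition monomial (a : 'I_m.+1) (b : 'I_n.+1) : 'X_{1.. 2 + 2} :=
  [multinom match split l with
            | inl p => if val p == 0%N then val a else (m - a)%N
            | inr q => if val q == 0%N then val b else (n - b)%N
            end | l < 2 + 2].

Definition bipoly (F : 'M[k]_(m.+1, n.+1)) : coord_ring k :=
  \sum_a \sum_b F a b *: 'X_[monomial a b].

Definition pairing (F T : 'M[k]_(m.+1, n.+1)) : k := \sum_a \sum_b F a b * T a b.

Lemma monomialE a b : [/\ monomial a b (lshift 2 0) = a, monomial a b (lshift 2 1) = (m - a)%N,
  monomial a b (rshift 2 0) = b & monomial a b (rshift 2 1) = (n - b)%N].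
Proof.
by rewrite !mnmE (unsplitK (inl 0)) (unsplitK (inl 1)) (unsplitK (inr 0)) (unsplitK (inr 1)).
Qed.

Lemma monomial_bidegree a b : bidegree (monomial a b) = (m, n).
Proof.
rewrite /bidegree !big_ord_recl !big_ord0 !addn0.
have [e1 e2 e3 e4] := monomialE a b.
have -> : lift ord0 ord0 = 1 :> 'I_2 by apply: val_inj.
by rewrite e1 e2 e3 e4 !subnKC // -ltnS.
Qed.

Lemma bidegree_monomial (d : 'X_{1.. 2 + 2}) : bidegree d = (m, n) ->
  exists a b, d = monomial a b.
Proof.
rewrite /bidegree !big_ord_recl !big_ord0 !addn0.
have -> : lift ord0 ord0 = 1 :> 'I_2 by apply: val_inj.
move=> [dm dn].
have am : (d (lshift 2 (ord0 : 'I_2)) < m.+1)%N by rewrite ltnS -dm leq_addr.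
have bn : (d (rshift 2 (ord0 : 'I_2)) < n.+1)%N by rewrite ltnS -dn leq_addr.
exists (Ordinal am), (Ordinal bn).
have [e1 e2 e3 e4] := monomialE (Ordinal am) (Ordinal bn).
apply/mnmP => l; rewrite -(splitK l); case: (split l) => -[[|[|//]] lt] /=.
- by rewrite (_ : Ordinal lt = 0) ?e1 //; apply: val_inj.
- by rewrite (_ : Ordinal lt = 1) ?e2 /= -?dm ?addKn //; apply: val_inj.
- by rewrite (_ : Ordinal lt = 0) ?e3 //; apply: val_inj.
- by rewrite (_ : Ordinal lt = 1) ?e4 /= -?dn ?addKn //; apply: val_inj.
Qed.

Lemma monomial_inj a b a' b' : monomial a b = monomial a' b' -> a = a' /\ b = b'.
Proof.
move=> E; have [e1 _ e3 _] := monomialE a b; have [e1' _ e3' _] := monomialE a' b'.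
by split; apply: val_inj; rewrite /= -?e1 -?e3 -?e1' -?e3' E.
Qed.

Lemma bipoly_coef F a b : (bipoly F)@_(monomial a b) = F a b.
Proof.
have E a' b' : (F a' b' *: 'X_[monomial a' b'] : coord_ring k)@_(monomial a b) =
    F a' b' * ((a' == a) && (b' == b))%:R.
  rewrite mcoeffZ mcoeffX; congr (_ * _%:R); congr nat_of_bool.
  apply/eqP/andP => [/monomial_inj[-> ->]//|[/eqP-> /eqP->]//].
rewrite /bipoly raddf_sum (bigD1 a) //= raddf_sum (bigD1 b) //=.
rewrite E !eqxx mulr1 !big1 ?addr0 // => [a' aa|b' bb].
  by rewrite raddf_sum big1 // => b' _; rewrite /= E (negPf aa) mulr0.
by rewrite E (negPf bb) andbF mulr0.
Qed.

Lemma bipoly_bihomog F : bihomog (m, n) (bipoly F).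
Proof.
have sub := subspace_bihomog k (m, n).
apply: (big_ind (bihomog (m, n))) => [|f g|a _]; [exact: sub.1|exact: subspaceD|].
apply: (big_ind (bihomog (m, n))) => [|f g|b _]; [exact: sub.1|exact: subspaceD|].
apply: (subspaceZ _ sub) => d; rewrite msuppX inE => /eqP->.
exact: monomial_bidegree.
Qed.

Lemma bihomogP (f : coord_ring k) : bihomog (m, n) f -> exists F, f = bipoly F.
Proof.
move=> hf; exists (\matrix_(a, b) f@_(monomial a b)); apply/mpolyP => d.
have [|nd] := pselect (bidegree d = (m, n)).
  by move=> /bidegree_monomial[a [b ->]]; rewrite bipoly_coef mxE.
rewrite memN_msupp_eq0; last by apply/negP => /hf.
by rewrite memN_msupp_eq0 //; apply/negP => /bipoly_bihomog.
Qed.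

Lemma bipoly_eval F (u v : 'rV[k]_2) :
  (bipoly F).@[fun l => row_mx u v 0 l] = pairing F ((powers m u)^T *m powers n v).
Proof.
rewrite /bipoly raddf_sum; apply: eq_bigr => a _ /=.
rewrite raddf_sum; apply: eq_bigr => b _ /=.
rewrite mevalZ mevalX; congr (_ * _).
rewrite !mxE big_ord1 !mxE big_split_ord !big_ord_recl !big_ord0 /= !mulr1.
have -> : lift ord0 ord0 = 1 :> 'I_2 by apply: val_inj.
have [e1 e2 e3 e4] := monomialE a b.
by rewrite !row_mxEl !row_mxEr e1 e2 e3 e4.
Qed.

Lemma pairingDl (x : k) F G T : pairing (x *: F + G) T = x * pairing F T + pairing G T.
Proof.
rewrite /pairing mulr_sumr -big_split; apply: eq_bigr => a _ /=.
rewrite mulr_sumr -big_split; apply: eq_bigr => b _ /=.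
by rewrite !mxE mulrDl mulrA.
Qed.

Lemma pairingZl (x : k) F T : pairing (x *: F) T = x * pairing F T.
Proof.
rewrite /pairing mulr_sumr; apply: eq_bigr => a _ /=.
by rewrite mulr_sumr; apply: eq_bigr => b _ /=; rewrite !mxE mulrA.
Qed.

Lemma pairingC F T : pairing F T = pairing T F.
Proof. by apply: eq_bigr => a _; apply: eq_bigr => b _; rewrite mulrC. Qed.

Lemma bipoly_is_linear : linear (bipoly : _ -> coord_ring k).
Proof.
move=> x F G; rewrite /bipoly scaler_sumr -big_split; apply: eq_bigr => a _ /=.
rewrite scaler_sumr -big_split; apply: eq_bigr => b _ /=.
by rewrite !mxE scalerDl scalerA.
Qed.

HB.instance Definition _ := GRing.isLinear.Build k _ _ _ bipoly bipoly_is_linear.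

(** If the forms vanishing on Z are those orthogonal to s, then dual to a basis of the
    span of s there are forms whose classes are a basis of S_(m,n) / I(Z)_(m,n):
    a form is determined modulo I(Z) by its pairings with the basis. *)
Lemma hilbert_dim (Z : set (quadric k)) (s : seq 'M[k]_(m.+1, n.+1)) :
  (forall F, ideal_of Z (bipoly F) <-> (forall T, T \in s -> pairing F T = 0)) ->
  quot_dim (bihomog (m, n)) (ideal_of Z `&` bihomog (m, n)) = \dim <<s>>%VS.
Proof.
move=> idP; set U := <<s>>%VS; pose X := vbasis U.
(* the coordinate functionals of X, as coefficient matrices *)
pose F l : 'M[k]_(m.+1, n.+1) := \matrix_(a, b) coord X l (delta_mx a b).
have FE l T : pairing (F l) T = coord X l T.
  rewrite [in RHS](matrix_sum_delta T) raddf_sum; apply: eq_bigr => a _ /=.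
  rewrite raddf_sum; apply: eq_bigr => b _ /=.
  by rewrite linearZ /= mxE mulrC.
have idP' G : ideal_of Z (bipoly G) <-> (forall l : 'I_(\dim U), pairing G X`_l = 0).
  have pl : linear (pairing G : _ -> k^o).
    by move=> x A B; rewrite ![pairing G _]pairingC pairingDl.
  pose h : {linear 'M[k]_(m.+1, n.+1) -> k^o} := HB.pack (pairing G) (GRing.isLinear.Build _ _ _ _ (pairing G) pl).
  have ker T : (T \in lker (linfun h)) = (pairing G T == 0).
    by rewrite memv_ker (lfunE h).
  rewrite idP; split=> vanish.
    have sub : (U <= lker (linfun h))%VS.
      by apply/span_subvP => T /vanish; rewrite ker => ->.
    move=> l; apply/eqP; rewrite -ker; apply: (subvP sub); apply: vbasis_mem.
    by rewrite -tnth_nth mem_tnth.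
  have sub : (U <= lker (linfun h))%VS.
    rewrite -(span_basis (vbasisP U)); apply/span_subvP => T /tnthP[l ->].
    by rewrite ker (tnth_nth 0) vanish.
  move=> T Ts; apply/eqP; rewrite -ker; apply: (subvP sub); exact: memv_span.
apply: (@quot_dimE _ _ _ _ _ (fun l => bipoly (F l))).
- exact: subspace_bihomog.
- exact: subspaceI (subspace_ideal_of Z) (subspace_bihomog k (m, n)).
split=> [l|f /bihomogP[G ->]]; first exact: bipoly_bihomog.
have E (c : 'rV[k]_(\dim U)) : bipoly G - \sum_l c 0 l *: bipoly (F l) =
    bipoly (G - \sum_l c 0 l *: F l).
  by rewrite [RHS]linearB [in RHS](linear_sum bipoly); congr (_ - _); apply: eq_bigr => l _; rewrite linearZ.
have P (c : 'rV[k]_(\dim U)) (l : 'I_(\dim U)) : pairing (G - \sum_l c 0 l *: F l) X`_l =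
    pairing G X`_l - c 0 l.
  have pl : linear (fun A => pairing A X`_l : k^o) by move=> x A B; rewrite pairingDl.
  pose h : {linear 'M[k]_(m.+1, n.+1) -> k^o} := HB.pack (fun A => pairing A X`_l) (GRing.isLinear.Build _ _ _ _ _ pl).
  rewrite -[LHS]/(h _) [LHS]linearB (linear_sum h); congr (_ - _).
  rewrite -[in RHS](mulr1 (c 0 l)) (bigD1 l) //= pairingZl FE.
  rewrite (coord_free _ _ (basis_free (vbasisP U))) eqxx big1 ?addr0 // => l' l'l.
  rewrite pairingZl FE (coord_free _ _ (basis_free (vbasisP U))).
  by rewrite eq_sym (negPf l'l) mulr0.
exists (\row_l pairing G X`_l); split.
  rewrite E; split; last exact: bipoly_bihomog.
  by apply/idP' => l; rewrite P mxE subrr.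
move=> c []; rewrite E => /idP' vanish _; apply/rowP => l; rewrite mxE.
by apply/eqP; rewrite -subr_eq0 -P vanish.
Qed.

End Forms.

(** * Lines on the quadric *)

Section Lines.
Variable k : closedFieldType.
Implicit Types (u w : 'rV[k]_2) (L : P1 k).

Lemma P1_point L : exists2 w, w != 0 & sval L = <[w]>%VS.
Proof.
case: L => L /= dL; exists (vpick L).
  by rewrite vpick0 -dimv_eq0 (eqP dL).
apply/esym/eqP; rewrite eqEdim (eqP dL) dim_vline vpick0 -dimv_eq0 (eqP dL).
by rewrite -memvE memv_pick.
Qed.

Lemma mem_linep u w : w != 0 -> reflect (exists x, u = x *: w) (~~ independent u w).
Proof.
move=> wn; rewrite /independent negbK subr_eq0.
have eqv u' : u' 0 0 = u 0 0 -> u' 0 1 = u 0 1 -> u = u'.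
  move=> e0 e1; apply/rowP => -[[|[|//]] lt].
    by rewrite (_ : Ordinal lt = 0) ?e0 //; apply: val_inj.
  by rewrite (_ : Ordinal lt = 1) ?e1 //; apply: val_inj.
apply: (iffP eqP) => [E|[x ->]]; last by rewrite !mxE; ring.
have [z|z] := eqVneq (w 0 0) 0.
  have z1 : w 0 1 != 0.
    apply: contraNneq wn => z1; apply/eqP/rowP => -[[|[|//]] lt]; rewrite mxE.
      by rewrite (_ : Ordinal lt = 0) ?z //; apply: val_inj.
    by rewrite (_ : Ordinal lt = 1) ?z1 //; apply: val_inj.
  exists (u 0 1 / w 0 1); apply: eqv; rewrite !mxE ?divfK // z mulr0.
  by move/eqP: E; rewrite z mulr0 mulf_eq0 (negPf z1) orbF => /eqP.
exists (u 0 0 / w 0 0); apply: eqv; rewrite !mxE ?divfK //.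
by rewrite mulrAC E mulfK.
Qed.

Lemma mem_P1 L u w : w != 0 -> w \in sval L -> (u \in sval L) = ~~ independent u w.
Proof.
have [w' w'n ->] := P1_point L => wn /vlineP[x wE].
have xn : x != 0 by apply: contraNneq wn => x0; rewrite wE x0 scale0r.
apply/vlineP/(mem_linep _ wn) => -[y ->]; [exists (y / x)|exists (y * x)].
  by rewrite wE scalerA divfK.
by rewrite wE scalerA.
Qed.

Definition mkP1 u (un : u != 0) : P1 k.
Proof. by exists <[u]>%VS; rewrite dim_vline un. Defined.

(** A form of bidegree (m, n) is multiplied by x^m y^n when the coordinates of the
    point are rescaled by x and y, so that one choice of coordinates suffices. *)
Lemma vanishesE m n (F : 'M[k]_(m.+1, n.+1)) (p : quadric k) u v :
  u != 0 -> u \in sval p.1 -> v != 0 -> v \in sval p.2 ->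
  vanishes (bipoly F) p <-> pairing F ((powers m u)^T *m powers n v) = 0.
Proof.
move=> un up vn vp; split=> [/(_ u v un up vn vp)|F0 u' v' u'n u'p v'n v'p].
  by rewrite bipoly_eval.
rewrite bipoly_eval.
have powersZ l x (w : 'rV[k]_2) : powers l (x *: w) = x ^+ l *: powers l w.
  apply/rowP => t; rewrite !mxE !exprMn.
  have -> : x ^+ l = x ^+ t * x ^+ (l - t) by rewrite -exprD subnKC // -ltnS.
  by ring.
have := mem_P1 u' un up; rewrite u'p => /esym/(mem_linep _ un)[x ->].
have := mem_P1 v' vn vp; rewrite v'p => /esym/(mem_linep _ vn)[y ->].
rewrite !powersZ [(_ *: _)^T]linearZ /= -scalemxAl -scalemxAr pairingC !pairingZl pairingC F0.
by rewrite !mulr0.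
Qed.

(** The linear form F_0 x_1 + F_1 x_0 has the single zero (F_0 : -F_1). *)
Lemma line_first (R : set (quadric k)) : is_line (1, 0)%N R ->
  exists2 u, u != 0 & forall p, R p <-> u \in sval p.1.
Proof.
move=> [f [fn /bihomogP[F fE] ->]]; rewrite {}fE in fn *.
pose u : 'rV[k]_2 := \row_l (if l == 0 then F 0 0 else - F 1 0).
exists u.
  apply: contraNneq fn => u0; suff -> : F = 0 by rewrite raddf0.
  apply/matrixP => s t; rewrite (ord1 t) mxE; move/rowP/(_ s): u0; rewrite !mxE.
  have [->|s0] := eqVneq s 0; first by [].
  by move/eqP; rewrite oppr_eq0 => /eqP <-; congr (F _ _); case: s s0 => [[|[|]]] // *; apply: val_inj.
move=> p; have [w wn pw] := P1_point p.1; have [v vn pv] := P1_point p.2.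
have wp : w \in sval p.1 by rewrite pw memv_line.
have vp : v \in sval p.2 by rewrite pv memv_line.
rewrite /zero_locus /= (vanishesE _ wn wp vn vp) (mem_P1 _ wn wp).
rewrite /independent negbK /pairing !big_ord_recl !big_ord0 !mxE !big_ord1 !mxE.
have -> : lift ord0 ord0 = 1 :> 'I_2 by apply: val_inj.
rewrite /= !subn0 !subnn !expr0 !expr1 !mulr1 !addr0.
split=> [E|/eqP E]; [apply/eqP|]; rewrite -[RHS]E; ring.
Qed.

Lemma line_second (R : set (quadric k)) : is_line (0, 1)%N R ->
  exists2 u, u != 0 & forall p, R p <-> u \in sval p.2.
Proof.
move=> [f [fn /bihomogP[F fE] ->]]; rewrite {}fE in fn *.
pose u : 'rV[k]_2 := \row_l (if l == 0 then F 0 0 else - F 0 1).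
exists u.
  apply: contraNneq fn => u0; suff -> : F = 0 by rewrite raddf0.
  apply/matrixP => s t; rewrite (ord1 s) mxE; move/rowP/(_ t): u0; rewrite !mxE.
  have [->|t0] := eqVneq t 0; first by [].
  by move/eqP; rewrite oppr_eq0 => /eqP <-; congr (F _ _); case: t t0 => [[|[|]]] // *; apply: val_inj.
move=> p; have [w wn pw] := P1_point p.1; have [v vn pv] := P1_point p.2.
have wp : w \in sval p.1 by rewrite pw memv_line.
have vp : v \in sval p.2 by rewrite pv memv_line.
rewrite /zero_locus /= (vanishesE _ wn wp vn vp) (mem_P1 _ vn vp).
rewrite /independent negbK /pairing !big_ord_recl !big_ord0 !mxE !big_ord1 !mxE.
have -> : lift ord0 ord0 = 1 :> 'I_2 by apply: val_inj.
rewrite /= !subn0 !subnn !expr0 !expr1 !mulr1 !addr0.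
split=> [E|/eqP E]; [apply/eqP|]; rewrite -[RHS]E; ring.
Qed.

End Lines.

(** * Admissible matrices *)

Section Admissible.
Variable M : int -> int -> int.
Hypothesis adm : admissible M.

Definition deltaN (i j : nat) : int := Delta M i j.
Definition amatN (i j : nat) : nat := `|amat M i j|%N.
Definition bmatN (i j : nat) : nat := `|bmat M i j|%N.

Lemma amatNE i j : Posz (amatN i j) = amat M i j.
Proof.
by rewrite /amatN gez0_abs // amatE //; case: adm => _ _ _ [_ + _ _]; apply.
Qed.

Lemma bmatNE i j : Posz (bmatN i j) = bmat M i j.
Proof.
by rewrite /bmatN gez0_abs // bmatE //; case: adm => _ _ _ [+ _ _ _]; apply.
Qed.

Lemma admissible_staircase : staircase deltaN amatN bmatN.
Proof.
have [_ [le1 [K cK]] mono [_ _ bm am]] := adm.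
split => //.
- by move=> i j r s cij ir js; apply: mono cij _ _ ir js.
- by move=> j; rewrite amatNE amatE // big_ord1.
- by move=> i j; rewrite !amatNE !amatE // big_ord_recr.
- by move=> i; rewrite bmatNE bmatE // big_ord1.
- by move=> i j; rewrite !bmatNE !bmatE // big_ord_recr.
- by move=> i j; rewrite -lez_nat !amatNE !amatE //; apply: (am i j.+1).
- by move=> i j; rewrite -lez_nat !bmatNE !bmatE //; apply: (bm i.+1 j).
- by exists K.
Qed.

Lemma in_TIE (e : mark) : is_mark deltaN e -> in_TI M e.1.1 e.1.2 e.2.
Proof. by move=> d; split=> //; apply: (mark_neg d). Qed.

Lemma mrowE (e : mark) : amat M e.1.1 e.1.2 + Posz e.2 = mrow amatN e.
Proof. by rewrite /mrow PoszD amatNE. Qed.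

Lemma mcolE (e : mark) : bmat M e.1.1 e.1.2 + Posz e.2 = mcol bmatN e.
Proof. by rewrite /mcol PoszD bmatNE. Qed.

Lemma plain_regular : plain M -> Delta_regular M -> regular deltaN amatN bmatN.
Proof.
move=> pl dr.
pose pair2 (x y : nat) (s : 'I_2) := if s == 0 then x else y.
have inj (x y : nat) : x <> y -> injective (pair2 x y).
  move=> xy [[|[|//]] ls] [[|[|//]] lt]; rewrite /pair2 /= => E; try exact: val_inj.
  by case: xy.
have homo (x y : nat) : (x < y)%N -> {homo pair2 x y : s t / (s < t)%N}.
  by move=> xy [[|[|]]] // ? [[|[|]]].
have reg e e' : is_mark deltaN e -> is_mark deltaN e' ->
  (mrow amatN e = mrow amatN e' -> e.1.1 <> e'.1.1 -> (e.1.2 < e'.1.2)%N -> (mcol bmatN e <= mcol bmatN e')%N) /\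
  (mcol bmatN e = mcol bmatN e' -> e.1.2 <> e'.1.2 -> (e.1.1 < e'.1.1)%N -> (mrow amatN e <= mrow amatN e')%N).
  move=> d d'.
  pose I := pair2 e.1.1 e'.1.1; pose J := pair2 e.1.2 e'.1.2; pose r := pair2 e.2 e'.2.
  have T s : in_TI M (I s) (J s) (r s).
    by rewrite /I /J /r /pair2; case: eqP => _; apply: in_TIE.
  have [h1 h2] := dr 2 I J r T.
  have aE s : amat M (I s) (J s) + Posz (r s) = pair2 (mrow amatN e) (mrow amatN e') s.
    by rewrite /I /J /r /pair2; case: eqP => _; rewrite mrowE.
  have bE s : bmat M (I s) (J s) + Posz (r s) = pair2 (mcol bmatN e) (mcol bmatN e') s.
    by rewrite /I /J /r /pair2; case: eqP => _; rewrite mcolE.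
  split=> eq ne lt.
    have := h1 _ (inj _ _ ne) (homo _ _ lt) 0 1 isT; rewrite !bE lez_nat; apply.
    by move=> s t; rewrite !aE /pair2 eq !if_same.
  have := h2 _ (inj _ _ ne) (homo _ _ lt) 0 1 isT; rewrite !aE lez_nat; apply.
  by move=> s t; rewrite !bE /pair2 eq !if_same.
split=> e e' d d'; [|exact: (reg e e' d d').1|exact: (reg e e' d d').2].
move=> re ce; have [ss|ss] := eqVneq e.1 e'.1.
  case: e e' ss re ce {d d'} => [p r] [p' r'] /= ->.
  by rewrite /mrow /= => /addnI ->.
exfalso; apply: (pl _ _ _ _ _ _ (in_TIE d) (in_TIE d')).
  by move=> E; move/eqP: ss; apply; rewrite [e.1]surjective_pairing E -surjective_pairing.
by rewrite !mrowE !mcolE re ce.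
Qed.

Lemma sum_delta_grid (i j : nat) : M i j = \sum_(p <- grid i.+1 j.+1) deltaN p.1 p.2.
Proof.
have M0 : forall z, M z (-1) = 0 by case: adm => M0 _ _ _ z; apply: M0; rewrite orbT.
have iotaE n (F : nat -> int) : \sum_(x <- iota 0 n) F x = \sum_(x < n) F x.
  by rewrite -(big_mkord xpredT) /index_iota subn0.
rewrite big_allpairs exchange_big iotaE.
under eq_bigr do rewrite iotaE -amatE //.
elim: j => [|j IH]; first by rewrite big_ord1 /amat /= (M0 i) subr0.
rewrite big_ord_recr /= -IH /amat (_ : j.+1%:Z - 1 = j) 1?addrC ?subrK //; lia.
Qed.

End Admissible.

(** Transposing M exchanges the two alternatives of the hypothesis. *)
Lemma admissible_capturing_balanced M : admissible M -> plain M -> Delta_regular M ->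
  (forall i j : nat, amat M (i%:Z - 1) (j%:Z + 1) <= amat M i j) \/
             (forall i j : nat, bmat M (i%:Z + 1) (j%:Z - 1) <= bmat M i j) ->
  capturing (deltaN M) (amatN M) (bmatN M) /\ balanced (deltaN M) (amatN M) (bmatN M).
Proof.
move=> adm pl dr; have st := admissible_staircase adm.
have rg := plain_regular adm pl dr.
have predE (i : nat) : i.+1%:Z - 1 = i by lia.
have succE (j : nat) : j%:Z + 1 = j.+1 by lia.
case=> cond.
  have cond' i j : (amatN M i j.+1 <= amatN M i.+1 j)%N.
    by rewrite -lez_nat !amatNE //; have := cond i.+1 j; rewrite predE succE.
  by split; [apply: antidiagonal_capturing | apply: antidiagonal_balanced].
have cond' i j : (transp (bmatN M) i j.+1 <= transp (bmatN M) i.+1 j)%N.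
  by rewrite /transp -lez_nat !bmatNE //; have := cond j i.+1; rewrite predE succE.
have st' := staircase_transp st; have rg' := regular_transp rg.
split; [apply: capturing_transp | apply: balanced_transp].
  exact: antidiagonal_capturing.
exact: antidiagonal_balanced.
Qed.

Theorem theorem6 (k : closedFieldType) (M : int -> int -> int) (a b : int)
    (hadm : admissible M) (hsize : of_size M a b)
    (hplain : plain M) (hreg : Delta_regular M)
    (hcond : (forall i j : nat, amat M (i%:Z - 1) (j%:Z + 1) <= amat M i j) \/
             (forall i j : nat, bmat M (i%:Z + 1) (j%:Z - 1) <= bmat M i j))
    (Z : set (quadric k)) (hZ : associated M a b Z) :
  forall i j : int, M i j = hilbert_matrix Z i j.
Proof.
have st := admissible_staircase hadm; have rg := plain_regular hadm hplain hreg.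
have [cap bal] := admissible_capturing_balanced hadm hplain hreg hcond.
have [A [B [aA [cA _] bB [cB _]]]] := hsize.
have [R [C [[lR dR] [lC dC] ZE]]] := hZ.
have cAB x y : deltaN M x y = 1 -> (x < A)%N && (y < B)%N.
  move=> cxy; rewrite !ltnNge -negb_or; apply/negP => /orP[Ax|By].
    have := stair_mono st (_ : deltaN M A 0 <= 0) Ax (leq0n y).
    by rewrite cxy /deltaN cA => /(_ isT).
  have := stair_mono st (_ : deltaN M 0 B <= 0) (leq0n x) By.
  by rewrite cxy /deltaN cB => /(_ isT).
have /choice[u uP] (x : nat) : exists u : 'rV[k]_2, (x < A)%N ->
    u != 0 /\ forall p, R x p <-> u \in sval p.1.
  case: (ltnP x A) => [xA|_]; last by exists 0.
  by have [|u un up] := @line_first k (R x) (lR x _); [lia | exists u].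
have /choice[v vP] (y : nat) : exists v : 'rV[k]_2, (y < B)%N ->
    v != 0 /\ forall p, C y p <-> v \in sval p.2.
  case: (ltnP y B) => [yB|_]; last by exists 0.
  by have [|v vn vp] := @line_second k (C y) (lC y _); [lia | exists v].
have u_ind x y : (x < A)%N -> (y < A)%N -> x <> y -> independent (u x) (u y).
  move=> xA yA xy; apply: contrapT => /negP dep.
  have [xn xP] := uP x xA; have [yn yP] := uP y yA.
  apply: (dR x y); [lia|lia|by case|].
  have /(mem_linep _ yn)[t E] := dep.
  have tn : t != 0 by apply: contraNneq xn => t0; rewrite E t0 scale0r.
  apply/seteqP; split=> p /=; rewrite xP yP E; last exact: memvZ.
  by move=> /(memvZ t^-1); rewrite scalerA mulVf // scale1r.
have v_ind x y : (x < B)%N -> (y < B)%N -> x <> y -> independent (v x) (v y).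
  move=> xB yB xy; apply: contrapT => /negP dep.
  have [xn xP] := vP x xB; have [yn yP] := vP y yB.
  apply: (dC x y); [lia|lia|by case|].
  have /(mem_linep _ yn)[t E] := dep.
  have tn : t != 0 by apply: contraNneq xn => t0; rewrite E t0 scale0r.
  apply/seteqP; split=> p /=; rewrite xP yP E; last exact: memvZ.
  by move=> /(memvZ t^-1); rewrite scalerA mulVf // scale1r.
(* Z is the set of points of the cells of the diagram that no mark removes. Since
   distinct indices give distinct lines, a point lies on only one cell. *)
have ZP p : Z p <-> exists2 z, z \in remaining (deltaN M) (amatN M) (bmatN M) A B &
    u z.1 \in sval p.1 /\ v z.2 \in sval p.2.
  rewrite ZE; split=> [[[x [y [cxy [Rp Cp]]]] nD]|[[x y]]].
    have /andP[xA yB] := cAB _ _ cxy.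
    exists (x, y); last by split; [apply/(uP x xA).2 | apply/(vP y yB).2].
    rewrite mem_filter mem_diagram // /= /deltaN cxy eqxx andbT.
    apply/asboolPn => -[e [d rx cy]]; apply: nD.
    exists e.1.1, e.1.2, e.2; split; first exact: in_TIE.
    by rewrite mrowE // mcolE // rx cy; split.
  rewrite mem_filter mem_diagram // => /andP[/= /asboolPn nr /eqP cxy] [up vp].
  have /andP[xA yB] := cAB _ _ cxy.
  split; first by exists x, y; split=> //; split; [apply/(uP x xA).2 | apply/(vP y yB).2].
  move=> [s [t [r [[_ rd] [Rp Cp]]]]]; apply: nr.
  pose e : mark := (s, t, r); have d : is_mark (deltaN M) e := rd.
  have /andP[rA cB'] := cAB _ _ (mark_in_diagram st d).
  have {}Rp : R (mrow (amatN M) e) p by rewrite -mrowE.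
  have {}Cp : C (mcol (bmatN M) e) p by rewrite -mcolE.
  exists e; split=> //.
  - apply: contrapT => ne; have := u_ind _ _ rA xA ne; apply/negP.
    rewrite -(mem_P1 (L := p.1)) //; last exact: (uP x xA).1.
    exact/(uP _ rA).2.
  - apply: contrapT => ne; have := v_ind _ _ cB' yB ne; apply/negP.
    rewrite -(mem_P1 (L := p.2)) //; last exact: (vP y yB).1.
    exact/(vP _ cB').2.
move=> i j; case: hadm (hadm) => M0 _ _ _ hadm'.
case: i => i; last by rewrite M0.
case: j => j; last by rewrite M0 ?orbT.
rewrite /= sum_delta_grid //.
have gphi := @powers_general_position k i A u (fun x xA => (uP x xA).1) u_ind.
have gpsi := @powers_general_position k j B v (fun x xA => (vP x xA).1) v_ind.
rewrite -(dim_remaining st rg cap bal cAB gphi gpsi); congr Posz; apply/esym.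
apply: hilbert_dim => F; split=> [idF T|F0 p].
  move=> /mapP[[x y] xyZ ->].
  have /andP[xA yB] : (x < A)%N && (y < B)%N.
    by move: xyZ; rewrite mem_filter mem_diagram // => /andP[_ /eqP /cAB].
  have un := (uP x xA).1; have vn := (vP y yB).1.
  pose p : quadric k := (mkP1 un, mkP1 vn).
  have up : u x \in sval p.1 by apply: memv_line.
  have vp : v y \in sval p.2 by apply: memv_line.
  apply/(vanishesE _ un up vn vp); apply: idF; apply/ZP.
  by exists (x, y).
move=> /ZP[[x y] xyZ [up vp]].
have /andP[xA yB] : (x < A)%N && (y < B)%N.
  by move: xyZ; rewrite mem_filter mem_diagram // => /andP[_ /eqP /cAB].
apply/(vanishesE _ (uP x xA).1 up (vP y yB).1 vp); apply: F0.
exact: (map_f (tensor _ _) xyZ).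
Qed.
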